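(* Let $V$ be a simple Euclidean Jordan algebra with inner product $\langle x,y\rangle=\operatorname{tr}(xy)$, and let $\Omega$ be the irreducible symmetric cone associated with $V$. If $H$ is a self-scaled barrier functional for $\Omega$, then there exist constants $c_1>0$ and $c_0\in\mathbb{R}$ such that $$H(x)=-c_1\ln\det(x)+c_0\qquad\text{for all }x\in\Omega.$$
   Context: **Jordan algebras.** A Euclidean Jordan algebra is a finite-dimensional real commutative (not necessarily associative) algebra $V$ with identity $e$ satisfying $x^2(xy)=x(x^2y)$, equipped with an inner product that is associative, i.e. $\langle xy,z\rangle=\langle y,xz\rangle$ for all $x,y,z\in V$. It is simple if it has no nontrivial ideals. By the spectral theorem every $x\in V$ can be written $x=\sum_{i=1}^r\lambda_i c_i$, where $r$ is the rank of $V$, $c_1,\dots,c_r$ is a Jordan frame (complete system of orthogonal primitive idempotents) and $\lambda_1,\dots,\lambda_r\in\mathbb{R}$ are the eigenvalues of $x$. Then $\operatorname{tr}(x)=\sum_i\lambda_i$ and $\det(x)=\prod_i\lambda_i$. **The cone.** The symmetric cone associated with $V$ is $\Omega=\exp V=\{\exp x:x\in V\}$ with $\exp x=\sum_{n\ge0}x^n/n!$; equivalently, $\Omega$ is the interior of $\{x^2:x\in V\}$, i.e. the set of elements with all eigenvalues positive. It is an open convex cone that is self-dual and on which $\{g\in GL(V):g\Omega=\Omega\}$ acts transitively. $\Omega$ is irreducible exactly when $V$ is simple. **Self-scaled barriers.** Let $\Omega^\sharp=\{s\in V:\langle x,s\rangle>0\ \forall x\in\Omega\}$ (the definition in the paper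 follows the Nesterov–Todd convention; here $\Omega^\sharp=\Omega$). For a function $H$ on $\Omega$, the Hessian $H''(x):V\to V$ is the self-adjoint linear map with $D^2H(x)[u,v]=\langle H''(x)u,v\rangle$. A $\nu$-self-concordant logarithmically homogeneous barrier functional for $\Omega$ is a convex function $H\in C^3(\Omega,\mathbb{R})$ such that: $|D^3H(x)[h,h,h]|\le 2\,(D^2H(x)[h,h])^{3/2}$ for all $x\in\Omega$, $h\in V$; $H(x_k)\to+\infty$ whenever $x_k\in\Omega$ converges to a boundary point of $\Omega$; $H''(x)$ is non-singular for all $x\in\Omega$; and $H(tx)=H(x)-\nu\ln t$ for all $x\in\Omega$, $t>0$ (in particular $\langle H'(x),H''(x)^{-1}H'(x)\rangle\le\nu$). Such an $H$ is called self-scaled if (a) $H''(w)x\in\Omega^\sharp$ for all $x,w\in\Omega$, and (b) $H_\sharp\bigl(H''(w)x\bigr)=H(x)-2H(w)-\nu$ for all $x,w\in\Omega$, where $H_\sharp(s)=\max\{-\langle x,s\rangle-H(x):x\in\Omega\}$ for $s\in\Omega^\sharp$. A self-scaled barrier functional for $\Omega$ is such an $H$ for some parameter $\nu$. *)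

(* Defs.v *)
From HB Require Import structures.
From mathcomp Require Import all_boot all_order all_algebra.
From mathcomp Require Import all_classical all_reals all_analysis.

Set Implicit Arguments.
Unset Strict Implicit.
Unset Printing Implicit Defensive.

Import Order.TTheory GRing.Theory Num.Theory.
Import numFieldNormedType.Exports.

Local Open Scope classical_set_scope.
Local Open Scope ring_scope.

(* Finite-dimensional normed spaces.  All norms on such a space are equivalent,
   so the norm only provides the canonical topology; it need not be related to
   the inner product of a Jordan algebra carried by the space. *)
#[short(type="normedVectType")]
HB.structure Definition NormedVector (R : numFieldType) :=
  {V of NormedModule R V & Vector R V}.

Record euclideanJordanAlgebra (R : realType) (V : vectType R) := {
  jmul : {bilinear V -> V -> V};
  jone : V;
  jdot : {dot V for idfun};
  jmulC : commutative jmul;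
  jmul1 : left_id jone jmul;
  jordan_identity : forall x y,
    jmul (jmul x x) (jmul x y) = jmul x (jmul (jmul x x) y);
  jdotA : forall x y z, jdot (jmul x y) z = jdot y (jmul x z)
}.

Section JordanAlgebra.
Context {R : realType} {V : vectType R}.
Variable J : euclideanJordanAlgebra V.

Definition jideal (I : {vspace V}) : Prop :=
  forall x y, y \in I -> jmul J x y \in I.

Definition jsimple : Prop :=
  forall I : {vspace V}, jideal I -> I = 0%VS \/ I = fullv.

Definition jidempotent (c : V) : Prop := jmul J c c = c.

Definition jprimitive (c : V) : Prop :=
  [/\ jidempotent c, c != 0 &
    forall a b, jidempotent a -> jidempotent b -> jmul J a b = 0 ->
      c = a + b -> a = 0 \/ b = 0].

Definition jordan_frame (r : nat) (c : 'I_r -> V) : Prop :=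
  [/\ forall i, jprimitive (c i),
      forall i j, i != j -> jmul J (c i) (c j) = 0 &
      \sum_(i < r) c i = jone J].

(* The eigenvalues of x, with multiplicity, in an unspecified order.  By the
   spectral theorem the set below is never empty, and its elements are the
   rearrangements of one sequence, whose length is the rank of the algebra. *)
Definition jeigenvalues (x : V) : seq R :=
  xget [::] [set s : seq R | exists c : 'I_(size s) -> V,
    jordan_frame c /\ x = \sum_(i < size s) s`_i *: c i].

Definition jtr (x : V) : R := \sum_(l <- jeigenvalues x) l.

Definition jdet (x : V) : R := \prod_(l <- jeigenvalues x) l.

Definition jpow (x : V) (n : nat) : V := iter n (jmul J x) (jone J).

End JordanAlgebra.

Section Barriers.
Context {R : realType} {V : normedVectType R}.

(* Class C^k on an open set A, through iterated directional derivatives. *)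
Fixpoint continuously_differentiable (k : nat) (A : set V) (f : V -> R) :
    Prop :=
  if k is k'.+1 then
    (forall x, A x -> differentiable f x) /\
    (forall v, continuously_differentiable k' A ('D_v f))
  else forall x, A x -> {for x, continuous f}.

Definition D2 (f : V -> R) (x u v : V) : R := 'D_v ('D_u f) x.

Definition D3 (f : V -> R) (x u v w : V) : R := 'D_w ('D_v ('D_u f)) x.

Definition boundary (A : set V) : set V := closure A `\` interior A.

Definition is_max (A : set R) (m : R) : Prop := A m /\ ubound A m.

Variable J : euclideanJordanAlgebra V.

Definition jexp (x : V) : V :=
  limn (series (fun n => n`!%:R^-1 *: jpow J x n)).

Definition symmetric_cone : set V := range jexp.
Local Notation Omega := symmetric_cone.

Definition dual_cone : set V :=
  [set s | forall x, Omega x -> 0 < jdot J x s].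

(* The Riesz representative of D2 H x u; it exists and is unique as soon as
   D2 H x u is linear. *)
Definition hessian (H : V -> R) (x u : V) : V :=
  xget 0 [set w : V | forall v, jdot J w v = D2 H x u v].

(* Functions on Omega are represented by functions on V; as Omega is open, the
   definitions below only depend on their values on Omega. *)
Record lhsc_barrier (nu : R) (H : V -> R) : Prop := {
  barrier_convex : convex_function (Omega : set (convex_lmodType V)) H;
  barrier_C3 : continuously_differentiable 3 Omega H;
  barrier_self_concordant : forall x h, Omega x ->
    `|D3 H x h h h| <= 2 * (D2 H x h h) `^ (3 / 2);
  barrier_boundary : forall (u : nat -> V) (p : V),
    (forall k, Omega (u k)) -> boundary Omega p -> u @ \oo --> p ->
    (H \o u) @ \oo --> +oo;
  barrier_nonsingular : forall x, Omega x -> bijective (hessian H x);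
  barrier_log_homogeneous : forall x t, Omega x -> 0 < t ->
    H (t *: x) = H x - nu * ln t
}.

(* [is_conjugate H s m] : the conjugate of H takes the value m at s. *)
Definition is_conjugate (H : V -> R) (s : V) (m : R) : Prop :=
  is_max [set - jdot J x s - H x | x in Omega] m.

Definition self_scaled (nu : R) (H : V -> R) : Prop :=
  (forall x w, Omega x -> Omega w -> dual_cone (hessian H w x)) /\
  (forall x w, Omega x -> Omega w ->
    is_conjugate H (hessian H w x) (H x - 2 * H w - nu)).

Definition self_scaled_barrier (H : V -> R) : Prop :=
  exists nu : R, lhsc_barrier nu H /\ self_scaled nu H.

End Barriers.

(* Main.v *)
From HB Require Import structures.
Require Import Defs.
From mathcomp Require Import all_boot all_order all_algebra.
From mathcomp Require Import all_classical all_reals all_analysis.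
From mathcomp Require Import ring lra.
Set Implicit Arguments.
Unset Strict Implicit.
Unset Printing Implicit Defensive.
Import Order.TTheory GRing.Theory Num.Theory.
Import numFieldNormedType.Exports.
Local Open Scope classical_set_scope.
Local Open Scope ring_scope.

(* Write L(x) for the multiplication by x, < , > for the inner product and e for
   the unit.  Let v minimize H(x) + <x, x> / 2 on the cone, so that
   H'(v) = - v and H''(v) v = v.  The map H''(v) is self-adjoint, preserves the
   cone and, by the conjugacy equation, sends its boundary to its boundary;
   following a ray from v in the direction of an eigenvector shows that all the
   eigenvalues are 1, whence H''(v) = 1.

   For orthogonal idempotents c and d the function w |-> <H''(w) c, d> is
   nonnegative and vanishes at v, so its derivative vanishes there: D^3 H(v)[u]
   kills all such pairs (c, d), which by the spectral theorem forces
   D^3 H(v)[u] = L(f u) for some f u.  Symmetry of D^3 H(v) and homogeneity of H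
   then put v in the centre, that is, v = m e since the algebra is simple, and
   f u = - (2 / m) u.

   Finally let y be in the cone and x = - H'(y) = H''(y) y.  The conjugacy
   equation bounds w |-> <y, H''(w) x> - 2 H(w) from below, with equality at v.
   Differentiating at v gives x y = m^2 e, i.e. DH(y)[u y] = - m^2 <e, u>.
   Integrating along the path exp(t x) yields H(exp x) = H(e) - m^2 tr x. *)

(** * Self-adjoint maps *)

Section FiniteDimension.
Context {R : realType}.

Lemma continuous_sum_ord (T : topologicalType) (W : normedModType R) k
    (f : 'I_k -> T -> W) :
  (forall i, continuous (f i)) -> continuous (fun x => \sum_(i < k) f i x).
Proof.
move=> cf; rewrite (_ : (fun x => _) = \sum_(i < k) f i); last first.
  by apply/funext => x; rewrite fct_sumE.
elim/big_ind: _ => [x|g h cg ch x|i _]; last exact: cf.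
- exact: cst_continuous.
- exact: (continuousD (cg x) (ch x)).
Qed.

Lemma sphere_compact k : compact [set a : 'rV[R]_k | `|a| = 1].
Proof.
apply: bounded_closed_compact.
  by exists 1; split => // M M1 a /= ->; exact: ltW.
rewrite [X in closed X](_ : _ = Num.norm @^-1` [set x : R | x = 1])//.
by apply: closed_comp => [x _|]; [exact: norm_continuous|exact: closed_eq].
Qed.

Lemma sphere_min k (F : 'rV[R]_k -> R) : (0 < k)%N ->
  {in [set a | `|a| = 1], continuous F} ->
  exists2 c, `|c| = 1 & forall a, `|a| = 1 -> F c <= F a.
Proof.
move=> k0 cF.
have S0 : [set a : 'rV[R]_k | `|a| = 1] !=set0.
  have n0 : (const_mx 1 : 'rV[R]_k) != 0.
    apply/eqP => /rowP/(_ (Ordinal k0)); rewrite !mxE => /eqP.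
    by rewrite oner_eq0.
  exists (`|const_mx 1 : 'rV[R]_k|^-1 *: const_mx 1) => /=.
  by rewrite normrZ normfV normr_id mulVf// normr_eq0.
have /(compact_EVT_min S0 (sphere_compact (k := k)))[c] :
    {within [set a | `|a| = 1], continuous F}.
  exact: continuous_in_subspaceT.
by rewrite inE => c1 cmin; exists c => // a a1; apply: cmin; rewrite inE.
Qed.

End FiniteDimension.

Section Rayleigh.
Context {R : realType} {V : vectType R}.
Variable dot : {dot V for idfun}.

Lemma dotC u v : dot u v = dot v u.
Proof. by have := hermC dot u v; rewrite /= expr0 mul1r. Qed.

Lemma dot_gt0 u : u != 0 -> 0 < dot u u.
Proof. exact: neq0_dnorm_gt0. Qed.

Lemma dot_ge0 u : 0 <= dot u u.
Proof.
by have [->|/dot_gt0/ltW//] := eqVneq u 0; rewrite linear0l.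
Qed.

Lemma dot_eq0 u : dot u u = 0 -> u = 0.
Proof.
by move=> u0; apply/eqP/negPn/negP => /dot_gt0; rewrite u0 ltxx.
Qed.

(* The casts to V fix the inferred structure of V, so that these rules rewrite
   terms whose structure does not come from the bilinear form. *)
Lemma dotDl (x y z : V) : dot (x + y : V) z = dot x z + dot y z.
Proof. exact: linearDl. Qed.
Lemma dotDr (x y z : V) : dot x (y + z : V) = dot x y + dot x z.
Proof. exact: linearDr. Qed.
Lemma dotBl (x y z : V) : dot (x - y : V) z = dot x z - dot y z.
Proof. exact: linearBl. Qed.
Lemma dotBr (x y z : V) : dot x (y - z : V) = dot x y - dot x z.
Proof. exact: linearBr. Qed.
Lemma dotNl (x y : V) : dot (- x : V) y = - dot x y.
Proof. exact: linearNl. Qed.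
Lemma dotNr (x y : V) : dot x (- y : V) = - dot x y.
Proof. exact: linearNr. Qed.
Lemma dotZl (a : R) (x y : V) : dot (a *: x : V) y = a * dot x y.
Proof. exact: linearZl_LR. Qed.
Lemma dotZr (a : R) (x y : V) : dot x (a *: y : V) = a * dot x y.
Proof. exact: linearZr_LR. Qed.
Lemma dot0l (x : V) : dot (0 : V) x = 0. Proof. exact: linear0l. Qed.
Lemma dot0r (x : V) : dot x (0 : V) = 0. Proof. exact: linear0r. Qed.
Definition dotE :=
  (dotBl, dotBr, dotDl, dotDr, dotNl, dotNr, dotZl, dotZr, dot0l, dot0r).

(** Coordinates are kept in a row vector because [V] has no topology in this section, whereas the
    unit sphere of ['rV[R]_k] is compact. *)
Definition lincomb (W : lmodType R) k (b : 'I_k -> W) (a : 'rV[R]_k) : W :=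
  \sum_i a 0 i *: b i.

Lemma lincombZ (W : lmodType R) k (b : 'I_k -> W) t a :
  lincomb b (t *: a) = t *: lincomb b a.
Proof.
by rewrite /lincomb scaler_sumr; apply: eq_bigr => i _; rewrite mxE scalerA.
Qed.

Lemma dot_lincomb_continuous k (b c : 'I_k -> V) :
  continuous (fun a => dot (lincomb b a) (lincomb c a)).
Proof.
rewrite (_ : (fun a => _) = fun a : 'rV[R]_k =>
    \sum_i \sum_j a 0 i * (a 0 j * dot (b i) (c j))); last first.
  apply/funext => a; rewrite /lincomb linear_sumlz; apply: eq_bigr => i _ /=.
  rewrite linearZl_LR linear_sumr mulr_sumr; apply: eq_bigr => j _ /=.
  by rewrite linearZr_LR.
apply: continuous_sum_ord => i; apply: continuous_sum_ord => j a.
have cc l : continuous (fun x : 'rV[R]_k => x 0 l) by exact: coord_continuous.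
have c0 := @cst_continuous 'rV[R]_k R (dot (b i) (c j)) a.
exact (continuousM (cc i a) (continuousM (cc j a) c0)).
Qed.

Lemma quadratic_linear_coef_eq0 (b c : R) :
  (forall t, 0 <= b * t + c * t ^+ 2) -> b = 0.
Proof.
move=> bc0; apply/eqP/negPn/negP => b0.
have c0 : 0 < `|c| + 1 by rewrite ltr_wpDl.
(* At this [t] the polynomial equals b^2 / (|c| + 1) times c / (|c| + 1) - 1, and the second factor
   is negative. *)
pose t := - (b / (`|c| + 1)).
have := bc0 t.
have -> : b * t + c * t ^+ 2 = b ^+ 2 / (`|c| + 1) * (c / (`|c| + 1) - 1).
  by rewrite /t; field; rewrite gt_eqF.
rewrite pmulr_rge0; last by rewrite divr_gt0// exprn_even_gt0.
rewrite subr_ge0 ler_pdivlMr// mul1r leNgt => /negP; apply.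
by rewrite (le_lt_trans (ler_norm c))// ltrDl.
Qed.

(** Minimize the Rayleigh quotient over the unit sphere of coordinates. At the minimizer [u] the
    form <f w, w> - l <w, w>, nonnegative on [U], vanishes; so does its first-order term in the
    direction of the residual f u - l u, which is twice the squared length of that residual. *)
Lemma selfadjoint_eigenvector (f : {linear V -> V}) (U : {vspace V}) :
  (forall u, u \in U -> f u \in U) ->
  (forall u v, dot (f u) v = dot u (f v)) -> U != 0%VS ->
  exists2 u, u \in U /\ u != 0 & exists2 l, f u = l *: u &
    forall w, w \in U -> l * dot w w <= dot (f w) w.
Proof.
move=> fU fsym U0; set k := \dim U.
pose b (i : 'I_k) := (vbasis U)`_i.
have bU : basis_of U (vbasis U) := vbasisP U.
have lcU a : lincomb b a \in U.
  by apply: memv_suml => i _; rewrite memvZ// vbasis_mem// mem_nth// size_tuple.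
have lc0 a : a != 0 -> lincomb b a != 0.
  move=> a0; apply: contraNneq a0 => a0; apply/eqP/rowP => i; rewrite mxE.
  have /freeP := basis_free bU; apply => //.
have lcP w : w \in U -> exists a, w = lincomb b a.
  move=> wU; exists (\row_i coord (vbasis U) i w).
  rewrite {1}(coord_basis bU wU); apply: eq_bigr => i _; by rewrite mxE.
have k0 : (0 < k)%N by rewrite lt0n dimv_eq0.
pose F a := dot (lincomb (f \o b) a) (lincomb b a) /
  dot (lincomb b a) (lincomb b a).
have flc a : f (lincomb b a) = lincomb (f \o b) a.
  by rewrite linear_sum; apply: eq_bigr => i _; rewrite linearZ.
have cF : {in [set a | `|a| = 1], continuous F}.
  move=> a; rewrite inE /= => a1.
  have d0 : dot (lincomb b a) (lincomb b a) != 0.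
    by rewrite gt_eqF// dot_gt0// lc0// -normr_eq0 a1 oner_eq0.
  have cV := continuousV d0 (@dot_lincomb_continuous _ b b a).
  exact (continuousM (@dot_lincomb_continuous _ (f \o b) b a) cV).
have [c c1 cmin] := sphere_min k0 cF.
set u := lincomb b c; set l := F c.
have u0 : u != 0 by rewrite lc0// -normr_eq0 c1 oner_eq0.
have lmin w : w \in U -> l * dot w w <= dot (f w) w.
  have [->|w0] := eqVneq w 0; first by rewrite !linear0r ?mulr0 lexx.
  move=> /lcP[a wa]; have a0 : a != 0.
    by apply: contraNneq w0; rewrite wa => ->; rewrite -(scale0r 0) lincombZ scale0r.
  have na : `|a| != 0 by rewrite normr_eq0.
  have /cmin : `| `|a|^-1 *: a| = 1 by rewrite normrZ normfV normr_id mulVf.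
  rewrite -/l /F -!flc !lincombZ -wa [f (_ *: _)]linearZ !(dotZl, dotZr).
  have d0 := dot_gt0 w0.
  move=> h; rewrite -ler_pdivlMr//.
  suff <- : `|a|^-1 * (`|a|^-1 * dot (f w) w) /
      (`|a|^-1 * (`|a|^-1 * dot w w)) = dot (f w) w / dot w w by exact h.
  by field; rewrite na gt_eqF.
have lu : l * dot u u = dot (f u) u.
  by rewrite /l /F -flc divfK// gt_eqF// dot_gt0.
exists u; first by split; [exact: lcU|].
exists l => //; apply/eqP; rewrite -subr_eq0; apply/eqP/dot_eq0.
move gE : (f u - l *: u) => g; move/esym in gE.
have gU : g \in U by rewrite gE rpredB ?rpredZ ?fU ?lcU.
suff : 2 * dot g g = 0 by move/eqP; rewrite mulf_eq0 pnatr_eq0 => /eqP.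
apply: (@quadratic_linear_coef_eq0 _ (dot (f g) g - l * dot g g)) => t.
have := lmin (u + t *: g); rewrite rpredD ?rpredZ ?lcU// => /(_ isT).
have -> : f (u + t *: g) = f u + t *: f g by rewrite linearD linearZ.
rewrite -subr_ge0 !dotE.
have -> : dot g g = dot (f u) g - l * dot u g.
  by rewrite {1}gE !dotE.
have -> : dot (f g) u = dot (f u) g by rewrite fsym dotC.
rewrite (dotC g u) -[dot (f u) u]lu; congr (0 <= _); ring.
Qed.

End Rayleigh.

(** * Euclidean Jordan algebras *)

Section PredicateSpaces.
Context {R : realType} {V : vectType R}.

(** A subspace of maximal dimension inside [P] is all of [P]: the line of a missing vector could be
    added to it. *)
Lemma linear_pred_vspace (P : V -> Prop) :
  P 0 -> (forall (a : R) u v, P u -> P v -> P (a *: u + v)) ->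
  exists U : {vspace V}, forall u, u \in U <-> P u.
Proof.
move=> P0 PL.
pose Q n := `[< exists2 U : {vspace V}, \dim U = n & forall u, u \in U -> P u >].
have exQ : exists n, Q n.
  by exists 0%N; apply/asboolP; exists 0%VS;
    [rewrite dimv0|move=> u; rewrite memv0 => /eqP->].
have ubQ n : Q n -> (n <= \dim (fullv : {vspace V}))%N.
  by move=> /asboolP[U <- _]; exact/dimvS/subvf.
case: (ex_maxnP exQ ubQ) => n /asboolP[U dU UP] nmax.
exists U => u; split=> [/UP//|Pu].
apply/negPn/negP => uU.
have /nmax : Q (\dim (U + <[u]>)%VS).
  apply/asboolP; exists (U + <[u]>)%VS => // w /memv_addP[w1 w1U [w2]].
  by move=> /vlineP[k ->] ->; rewrite addrC; apply: PL => //; exact: UP.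
rewrite leqNgt => /negP; apply; rewrite -dU.
have := dimv_leqif_eq (addvSl U <[u]>); rewrite ltn_neqAle => -[-> ->].
rewrite andbT; apply: contra uU => /eqP ->.
by rewrite (subvP (addvSr U <[u]>))// memv_line.
Qed.

End PredicateSpaces.

Section EuclideanJordanAlgebra.
Context {R : realType} {V : vectType R}.
Variable J : euclideanJordanAlgebra V.
Local Notation "x ** y" := (jmul J x y) (at level 40, left associativity).
Local Notation "''[' x , y ]" := (jdot J x y).
Local Notation e := (jone J).

Lemma jDl (x y z : V) : (x + y : V) ** z = x ** z + y ** z. Proof. exact: linearDl. Qed.
Lemma jDr (x y z : V) : x ** (y + z : V) = x ** y + x ** z. Proof. exact: linearDr. Qed.
Lemma jBl (x y z : V) : (x - y : V) ** z = x ** z - y ** z. Proof. exact: linearBl. Qed.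
Lemma jBr (x y z : V) : x ** (y - z : V) = x ** y - x ** z. Proof. exact: linearBr. Qed.
Lemma jZl (a : R) (x y : V) : (a *: x : V) ** y = a *: (x ** y). Proof. exact: linearZl_LR. Qed.
Lemma jZr (a : R) (x y : V) : x ** (a *: y : V) = a *: (x ** y). Proof. exact: linearZr_LR. Qed.
Lemma j0l (x : V) : (0 : V) ** x = 0. Proof. exact: linear0l. Qed.
Lemma j0r (x : V) : x ** (0 : V) = 0. Proof. exact: linear0r. Qed.
Lemma jNl (x y : V) : (- x : V) ** y = - (x ** y). Proof. exact: linearNl. Qed.
Lemma jNr (x y : V) : x ** (- y : V) = - (x ** y). Proof. exact: linearNr. Qed.
Definition jE := (jBl, jBr, jDl, jDr, jNl, jNr, jZl, jZr, j0l, j0r).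
Definition dE := dotE (jdot J).

Lemma dot_inj u v : (forall w, '[u, w] = '[v, w]) -> u = v.
Proof.
move=> uv; apply/eqP; rewrite -subr_eq0; apply/eqP/(dot_eq0 (dot := jdot J)).
by rewrite dotBl uv subrr.
Qed.

Lemma jmulr1 x : x ** e = x. Proof. by rewrite jmulC jmul1. Qed.

Lemma jdot_sa x u v : '[x ** u, v] = '[u, x ** v].
Proof. exact: jdotA. Qed.

Lemma jdot1 x y : '[x ** y, e] = '[x, y].
Proof. by rewrite jmulC jdot_sa jmulr1 dotC. Qed.

(** Polarization: the Jordan identity at x + z minus the one at x - z, once the part cubic in [z] is
    removed by the identity at [z], is twice the part linear in [z]. *)
Lemma jordan_linearized (x y z : V) :
  (2 : R) *: ((x ** z) ** (x ** y)) + (x ** x) ** (z ** y) =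
  (2 : R) *: (x ** ((x ** z) ** y)) + z ** ((x ** x) ** y).
Proof.
(* Pairing with an arbitrary [w] turns an identity in [V] into one between real numbers, which [lra]
   can settle. *)
apply: dot_inj => w.
have jw a : '[(a ** a) ** (a ** y), w] = '[a ** ((a ** a) ** y), w].
  by rewrite jordan_identity.
have := jw (x + z); have := jw (x - z); have := jw z; have := jw x.
rewrite !jE !dE (jmulC J z x); lra.
Qed.

(** * Peirce eigenspaces of an idempotent *)

Section Peirce.
Variable c : V.
Hypothesis cc : jidempotent J c.

(** [L(c)] is annihilated by t (t - 1) (2 t - 1), so its eigenvalues are among 0, 1/2 and 1. *)
Lemma peirce_cubic (z : V) :
  (2 : R) *: (c ** (c ** (c ** z))) + c ** z = (3 : R) *: (c ** (c ** z)).
Proof.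
apply: dot_inj => w; have := congr1 (jdot J ^~ w) (jordan_linearized c c z).
rewrite !cc (jmulC J (c ** z) c) (jmulC J z c) !dE; lra.
Qed.

(* By [peirce_cubic], L = L(c) satisfies L = L^2 + 4 (L - L^2)^2. *)
Lemma idempotent_ge0 z : 0 <= '[c ** z, z].
Proof.
have h1 := congr1 (jdot J ^~ z) (peirce_cubic z).
have h2 := congr1 (jdot J ^~ z) (peirce_cubic (c ** z)).
rewrite /= !dE in h1 h2.
suff -> : '[c ** z, z] = '[c ** z, c ** z] +
    4 * '[c ** z - c ** (c ** z), c ** z - c ** (c ** z)].
  by rewrite addr_ge0// ?mulr_ge0// dot_ge0.
have sa u : '[u, c ** z] = '[c ** u, z] by rewrite jdot_sa.
have sa2 u : '[u, c ** (c ** z)] = '[c ** (c ** u), z] by rewrite !jdot_sa.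
rewrite !dE !(sa2, sa); lra.
Qed.

(** The two instances of the linearized identity put x y both in the 1-eigenspace and in the kernel
    of [L(c)]. *)
Lemma peirce10 x y : c ** x = x -> c ** y = 0 -> x ** y = 0.
Proof.
move=> cx cy.
have h1 := jordan_linearized c x y.
have h2 := jordan_linearized c y x.
rewrite cc cy cx ?(jE, cy, cx) in h1 h2.
rewrite (jmulC J y x) ?scaler0 ?add0r ?addr0 in h1.
move: h2; rewrite ?scaler0 ?add0r ?addr0 h1 => h2.
apply: dot_inj => w; have := congr1 (jdot J ^~ w) h2; rewrite /= !dE; lra.
Qed.

(** Thus [L(x)] commutes with [L(c)], which makes [L(x)] an admissible [T] in [bicommutes]. *)
Lemma peirce11 x y : c ** x = x -> x ** (c ** y) = c ** (x ** y).
Proof.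
move=> cx; have := jordan_linearized c y x; rewrite cc cx => h.
apply: dot_inj => w; have := congr1 (jdot J ^~ w) h; rewrite /= !dE; lra.
Qed.

End Peirce.

(** Meant for p x = x: the polynomials in [x], with the idempotent [p] in the role of the constant
    1. *)
Inductive krylov (x p : V) : V -> Prop :=
| krylov_base : krylov x p p
| krylov_mul f : krylov x p f -> krylov x p (x ** f)
| krylov_lin (a : R) f g : krylov x p f -> krylov x p g -> krylov x p (a *: f + g).

Section Krylov.
Variables p x : V.
Hypotheses (pp : jidempotent J p) (px : p ** x = x).

(** [L(f)] lies in the bicommutant of [L(x)], [L(x ** x)] and [L(p)]. *)
Let bicommutes f := forall T : {linear V -> V},
  (forall y, T (x ** y) = x ** T y) ->
  (forall y, T ((x ** x) ** y) = (x ** x) ** T y) ->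
  (forall y, T (p ** y) = p ** T y) -> forall y, T (f ** y) = f ** T y.

(* Stands in for power associativity: the proof closes under f |-> x f because
   L(x^2 f) is a polynomial in L(x), L(x^2), L(f) and L(x f). *)
Lemma krylov_bicommutes f : krylov x p f ->
  [/\ p ** f = f, bicommutes f & bicommutes (x ** f)].
Proof.
elim=> [|{}f _ [pf Bf Bxf]|a {}f g _ [pf Bf Bxf] _ [pg Bg Bxg]].
- by split; [exact: pp|by []|rewrite jmulC px].
- split=> //; first by rewrite -(peirce11 pp _ px) pf.
  (* [L(f)] commutes with [L(x)] by the bicommutant property; evaluate at [x]. *)
  have xxf : x ** (x ** f) = (x ** x) ** f.
    have := Bf (jmul J x) (fun _ => erefl) (fun y => esym (jordan_identity J x y))
      (fun y => peirce11 pp y px) x.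
    by rewrite !(jmulC J f).
  rewrite xxf => T Tx Txx Tp z.
  (* The linearized identity, solved for the multiplication by x^2 f. *)
  have E y : ((x ** x) ** f) ** y = (x ** x) ** (f ** y)
      + (2 : R) *: ((x ** f) ** (x ** y)) - (2 : R) *: (x ** (f ** (x ** y))).
    apply: dot_inj => w.
    have := congr1 (jdot J ^~ w) (jordan_linearized x f y).
    rewrite /= !dE (jmulC J y f) (jmulC J (x ** y) f) (jmulC J (x ** y) (x ** f)).
    rewrite (jmulC J y (_ ** f)); lra.
  rewrite !E linearB linearD !linearZ /= Txx Bf// Bxf// !Tx Bf//.
  by rewrite Tx.
- split=> [|T Tx Txx Tp y|T Tx Txx Tp y].
  + by rewrite !jE pf pg.
  + by rewrite !jE linearD linearZ /= Bf// Bg.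
  + by rewrite !jE linearD linearZ /= Bxf// Bxg.
Qed.

(** Induction on [g], since [L(f)] commutes with [L(x)]. Taking g = f makes f f a multiple of f,
    that is, [f] nearly an idempotent. *)
Lemma krylov_eigen f (l : R) g : krylov x p f -> x ** f = l *: f ->
  krylov x p g -> exists k : R, g ** f = k *: f.
Proof.
move=> Kf xf; elim=> [|{}g Kg [k gf]|a {}g h _ [k gf] _ [m hf]].
- by exists 1; rewrite scale1r; have [] := krylov_bicommutes Kf.
- exists (k * l); have [_ Bf _] := krylov_bicommutes Kf.
  have := Bf (jmul J x) (fun _ => erefl) (fun y => esym (jordan_identity J x y))
    (fun y => peirce11 pp y px) g.
  move=> h; rewrite jmulC -h (jmulC J f) gf.
 rewrite /= jZr.  by rewrite xf scalerA.
- by exists (a * k + m); rewrite !jE gf hf scalerA scalerDl.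
Qed.

(** The Krylov space is stable under [L(x)], so it contains an eigenvector [u]; then u u = k u, and
    u / k is idempotent. *)
Lemma idempotent_eigenvector : p != 0 ->
  exists (c : V) (l : R), [/\ jidempotent J c, c != 0, p ** c = c & x ** c = l *: c].
Proof.
move=> p0.
have K0 : krylov x p 0.
  have := krylov_lin (- 1) (krylov_base x p) (krylov_base x p).
  by rewrite scaleN1r addNr.
have [U UP] := linear_pred_vspace K0 (@krylov_lin x p).
have U0 : U != 0%VS.
  by apply: contraNneq p0 => U0; rewrite -memv0 -U0; apply/UP/krylov_base.
have [u [/UP Ku u0] [l xu _]] := @selfadjoint_eigenvector _ _ (jdot J)
  (jmul J x) U (fun u Uu => (UP _).2 (krylov_mul ((UP u).1 Uu))) (jdot_sa x) U0.
have [k uu] := krylov_eigen Ku xu Ku.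
(* Because <u, u> = <u u, e>. *)
have k0 : k != 0.
  apply: contraNneq u0 => k0; apply/eqP/(dot_eq0 (dot := jdot J)).
  by rewrite -jdot1 uu k0 scale0r dot0l.
have [pu _ _] := krylov_bicommutes Ku.
exists (k^-1 *: u), l; split.
- rewrite /jidempotent !jE uu.  by rewrite !scalerA -mulrA mulVf// mulr1.
- by rewrite scaler_eq0 invr_eq0 negb_or k0.
- by rewrite jZr pu.
- by rewrite jZr xu !scalerA mulrC.
Qed.

End Krylov.

(** * Splitting of idempotents and the spectral theorem *)

Definition peirce1 (p : V) : {vspace V} := lker (linfun (jmul J p) - \1)%VF.

Lemma mem_peirce1 p y : (y \in peirce1 p) = (p ** y == y).
Proof. by rewrite memv_ker !lfunE /= opp_lfunE id_lfunE lfunE subr_eq0. Qed.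

(** The vector [b] is gained. This dimension is the measure of the spectral induction. *)
Lemma peirce1_split a b : jidempotent J a -> jidempotent J b -> a ** b = 0 ->
  b != 0 -> (\dim (peirce1 a) < \dim (peirce1 (a + b)))%N.
Proof.
move=> aa bb ab b0.
have sub : (peirce1 a <= peirce1 (a + b))%VS.
  apply/subvP => y; rewrite !mem_peirce1 => /eqP ay.
  by rewrite jDl ay (jmulC J b) (peirce10 aa ay ab) addr0.
have := dimv_leqif_eq sub; rewrite ltn_neqAle => -[-> ->].
rewrite andbT; apply/negP => /eqP eqab.
have : b \in peirce1 (a + b) by rewrite mem_peirce1 jDl ab bb add0r.
by rewrite -eqab mem_peirce1 ab eq_sym (negbTE b0).
Qed.

Definition cat_fun (T : Type) m n (f : 'I_m -> T) (g : 'I_n -> T) (i : 'I_(m + n)) :=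
  match fintype.split i with inl j => f j | inr k => g k end.

Lemma cat_funP (T : Type) (P : T -> Prop) m n (f : 'I_m -> T) (g : 'I_n -> T) :
  (forall i, P (f i)) -> (forall i, P (g i)) -> forall i, P (cat_fun f g i).
Proof. by move=> Pf Pg i; rewrite /cat_fun; case: fintype.split. Qed.

Lemma cat_fun_lshift (T : Type) m n (f : 'I_m -> T) (g : 'I_n -> T) i :
  cat_fun f g (lshift n i) = f i.
Proof. by rewrite /cat_fun (unsplitK (inl _ i)). Qed.

Lemma cat_fun_rshift (T : Type) m n (f : 'I_m -> T) (g : 'I_n -> T) i :
  cat_fun f g (rshift m i) = g i.
Proof. by rewrite /cat_fun (unsplitK (inr _ i)). Qed.

(** For p = e this is a Jordan frame with the eigenvalues of [x]; other [p] serve the induction. *)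
Definition spectral_resolution (p x : V) r (c : 'I_r -> V) (l : 'I_r -> R) :=
  [/\ forall i, jprimitive J (c i), forall i j, i != j -> c i ** c j = 0,
      \sum_i c i = p, forall i, p ** c i = c i & x = \sum_i l i *: c i].

(** All the new orthogonality relations come from [peirce10]: first a d = 0 and b c = 0, then c d =
    0. *)
Lemma spectral_resolution_cat a b x y r c l s d m :
  jidempotent J a -> jidempotent J b -> a ** b = 0 ->
  @spectral_resolution a x r c l -> @spectral_resolution b y s d m ->
  spectral_resolution (a + b) (x + y) (cat_fun c d) (cat_fun l m).
Proof.
move=> aa bb ab [cp co cs ca xE] [dp od ds db yE].
have ba : b ** a = 0 by rewrite jmulC.
have ad j : a ** d j = 0 by rewrite jmulC (peirce10 bb (db j) ba).
have bc j : b ** c j = 0 by rewrite jmulC (peirce10 aa (ca j) ab).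
have cd i j : c i ** d j = 0 := peirce10 aa (ca i) (ad j).
split.
- exact: cat_funP.
- move=> i j; rewrite -(splitK i) -(splitK j) => ij.
  case: (fintype.split i) (fintype.split j) ij => [i'|i'] [j'|j'] /=;
    rewrite ?cat_fun_lshift ?cat_fun_rshift ?(inj_eq (@lshift_inj _ _))
      ?(inj_eq (@rshift_inj _ _)) //.
  + exact: co.
  + by rewrite jmulC.
  + exact: od.
- rewrite big_split_ord /= -cs -ds; congr (_ + _); apply: eq_bigr => i _.
    exact: cat_fun_lshift.
  exact: cat_fun_rshift.
- apply: (cat_funP (P := fun u => (a + b) ** u = u)) => i;
    by rewrite jDl ?ca ?db ?ad ?bc ?add0r ?addr0.
- rewrite big_split_ord /= xE yE; congr (_ + _); apply: eq_bigr => i _.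
    by rewrite !cat_fun_lshift.
  by rewrite !cat_fun_rshift.
Qed.

(** An idempotent eigenvector c != p splits [p] as c + (p - c) and [x] along with it. If c = p then
    [x] is a multiple of [p], so [p] is either primitive, which ends the induction, or splits in any
    way at all. *)
Lemma spectral_resolution_exists p x : jidempotent J p -> p ** x = x ->
  exists r c l, @spectral_resolution p x r c l.
Proof.
have [n] := ubnP (\dim (peirce1 p)); elim: n p x => // n IH p x pn pp px.
have [p0|p0] := eqVneq p 0.
  exists 0%N, (fun=> 0), (fun=> 0); split; try by case.
    by rewrite big_ord0 p0.
  by rewrite big_ord0 -px p0 j0l.
have step (a b y z : V) : jidempotent J a -> jidempotent J b -> a ** b = 0 ->
    a != 0 -> b != 0 -> p = a + b -> x = y + z -> a ** y = y -> b ** z = z ->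
    exists r c l, @spectral_resolution p x r c l.
  move=> aa bb ab a0 b0 pE xE ay bz.
  have dima : (\dim (peirce1 a) < n)%N.
    by rewrite -ltnS (leq_trans _ pn)// ltnS pE peirce1_split.
  have dimb : (\dim (peirce1 b) < n)%N.
    by rewrite -ltnS (leq_trans _ pn)// ltnS pE addrC peirce1_split// jmulC.
  have [r [c [l S]]] := IH a y dima aa ay.
  have [s [d [m T]]] := IH b z dimb bb bz.
  exists (r + s)%N, (cat_fun c d), (cat_fun l m).
  by rewrite pE xE; exact: spectral_resolution_cat.
have [c [l [cc c0 pc xc]]] := idempotent_eigenvector pp px p0.
have [cp|cp] := eqVneq c p; last first.
  apply: (step c (p - c) (l *: c) (x - l *: c)) => //.
  - by rewrite /jidempotent !jE [p ** p]pp (jmulC J c p) pc [c ** c]cc subrr subr0.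
  - by rewrite jBr cc (jmulC J c) pc subrr.
  - by rewrite subr_eq0 eq_sym.
  - by rewrite addrC subrK.
  - by rewrite addrC subrK.
  - by rewrite jZr cc.
  - rewrite !jE px pc (jmulC J c x) xc cc subrr subr0.
    by [].
have xl : x = l *: p by rewrite -cp -xc cp jmulC px.
have [prim|nprim] := pselect (jprimitive J p).
  exists 1%N, (fun=> p), (fun=> l); split => //.
  - by move=> i j; rewrite !ord1 eqxx.
  - by rewrite big_ord1.
  - by rewrite big_ord1.
have [a [b [aa bb ab pE [a0 b0]]]] : exists a b, [/\ jidempotent J a,
    jidempotent J b, a ** b = 0, p = a + b & a != 0 /\ b != 0].
  apply: contrapT => nab; apply: nprim; split=> // a b aa bb ab pE.
  have [->|a0] := eqVneq a 0; first by left.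
  have [->|b0] := eqVneq b 0; first by right.
  by exfalso; apply: nab; exists a, b.
apply: (step a b (l *: a) (l *: b)) => //.
- by rewrite -scalerDr -pE.
- by rewrite jZr aa.
- by rewrite jZr bb.
Qed.

Lemma spectral_theorem x : exists r (c : 'I_r -> V) (l : 'I_r -> R),
  jordan_frame J c /\ x = \sum_i l i *: c i.
Proof.
have ee : jidempotent J e by rewrite /jidempotent jmul1.
have [r [c [l [cp co cs _ xE]]]] := spectral_resolution_exists ee (jmul1 J x).
by exists r, c, l.
Qed.

(** The spectral theorem shows that the set in [jeigenvalues] is inhabited, so the default [[::]] of
    [xget] is never taken for want of a member. *)
Lemma jeigenvaluesP x : exists c : 'I_(size (jeigenvalues J x)) -> V,
  jordan_frame J c /\ x = \sum_(i < _) (jeigenvalues J x)`_i *: c i.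
Proof.
rewrite /jeigenvalues; case: xgetP => [s _ //|none].
have [r [c [l [cf xE]]]] := spectral_theorem x.
pose s := [seq l i | i <- enum 'I_r].
have sr : size s = r by rewrite size_map size_enum_ord.
exfalso; apply: (none s); exists (fun i => c (cast_ord sr i)); split.
  have [cp co cs] := cf; split=> // [i j ij|].
    by apply: co; rewrite (inj_eq (@cast_ord_inj _ _ _)).
  rewrite -cs (reindex (cast_ord sr)) //.
  by exists (cast_ord (esym sr)) => i _; rewrite ?cast_ordK ?cast_ordKV.
rewrite xE (reindex (cast_ord sr)) /=; last first.
  by exists (cast_ord (esym sr)) => i _; rewrite ?cast_ordK ?cast_ordKV.
apply: eq_bigr => i _; congr (_ *: _).
have ir : (i < r)%N by rewrite -[X in (_ < X)%N]sr.
rewrite (nth_map (cast_ord sr i)) ?size_enum_ord//; congr l.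
by apply: val_inj; rewrite /= nth_enum_ord.
Qed.

(** * Computing in a Jordan frame *)

Section Frame.
Variables (r : nat) (c : 'I_r -> V).
Hypothesis cf : jordan_frame J c.

Lemma frame_idem i : c i ** c i = c i.
Proof. by have [/(_ i)[]] := cf. Qed.

Lemma frame_mul (l : 'I_r -> R) i : c i ** (\sum_j l j *: c j) = l i *: c i.
Proof.
have [_ co _] := cf; rewrite linear_sumr (bigD1 i)//= jZr frame_idem.
rewrite big1 ?addr0// => j ji; by rewrite jZr co ?scaler0// eq_sym.
Qed.

Lemma frame_mul2 (l m : 'I_r -> R) : (\sum_j l j *: c j) ** (\sum_j m j *: c j) =
  \sum_j (l j * m j) *: c j.
Proof.
rewrite linear_sumlz; apply: eq_bigr => i _.
by rewrite linearZl_LR /= frame_mul scalerA.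
Qed.

Lemma frame_pow (l : 'I_r -> R) n : jpow J (\sum_j l j *: c j) n = \sum_j l j ^+ n *: c j.
Proof.
rewrite /jpow; elim: n => [|n IH] /=.
  by have [_ _ <-] := cf; apply: eq_bigr => j _; rewrite expr0 scale1r.
by rewrite IH frame_mul2; apply: eq_bigr => j _; rewrite exprS.
Qed.

Lemma frame_neq0 i : c i != 0.
Proof. by have [/(_ i)[]] := cf. Qed.

(** Replaces positive eigenvalues by a condition linear in the element and independent of the frame.
    The terms <c_j u, u> are nonnegative and add up to <u, u>; conversely, test on u = c_i. *)
Lemma frame_posP (l : 'I_r -> R) : (forall i, 0 < l i) <->
  (forall u, u != 0 -> 0 < '[(\sum_j l j *: c j) ** u, u]).
Proof.
split=> [l0 u u0|pos i].
  have E (m : 'I_r -> R) : '[(\sum_j m j *: c j) ** u, u] = \sum_j m j * '[c j ** u, u].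
    rewrite !linear_sumlz; apply: eq_bigr => i _; rewrite jZl /=.
    exact: dotZl.
  have ge0 (j : 'I_r) : 0 <= '[c j ** u, u] by exact/idempotent_ge0/frame_idem.
  rewrite E lt_neqAle sumr_ge0 ?andbT; last first.
    by move=> j _; rewrite mulr_ge0// ltW.
  apply: contraTneq u0 => /esym/eqP; rewrite psumr_eq0 => [/allP h|j _].
    apply/negPn/eqP/(dot_eq0 (dot := jdot J)).
    rewrite -{1}(jmul1 J u); have [_ _ <-] := cf.
    have := E (fun=> 1); under eq_bigr do rewrite scale1r.
    move=> ->; rewrite big1// => j _.
    have := h j (mem_index_enum _).
    by rewrite mulf_eq0 gt_eqF//= => /eqP->; rewrite mulr0.
  by rewrite mulr_ge0// ltW.
have := pos _ (frame_neq0 i); rewrite jmulC frame_mul dotZl.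
by rewrite pmulr_lgt0// dot_gt0// frame_neq0.
Qed.

End Frame.

(** The chosen frame need not contain [d] a priori. Idempotency makes a nonzero eigenvalue equal to
    1, and primitivity then identifies [d] with the corresponding member of the frame. *)
Lemma jtr_primitive d : jprimitive J d -> jtr J d = 1.
Proof.
move=> [dd d0 dprim].
have [c [cf dE]] := jeigenvaluesP d; rewrite /jtr.
set s := jeigenvalues J d in c cf dE *.
have cd i : c i ** d = s`_i *: c i by rewrite {1}dE (frame_mul cf (fun i => s`_i)).
have [i si] : exists i : 'I_(size s), s`_i != 0.
  apply: contrapT => ns; move/eqP: d0; apply; rewrite dE big1// => i _.
  have [->|si] := eqVneq s`_i 0; first by rewrite scale0r.
  by exfalso; apply: ns; exists i.
have s1 : s`_i = 1.
  have h : (s`_i * s`_i) *: c i = s`_i *: c i.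
    rewrite -(frame_mul cf (fun j => s`_j * s`_j)).
    by rewrite -(frame_mul2 cf) -dE dd cd.
  have /eqP := h; rewrite -subr_eq0 -scalerBl scaler_eq0.
  rewrite (negbTE (frame_neq0 cf i)) orbF -{3}(mulr1 s`_i) -mulrBr mulf_eq0.
  by rewrite (negbTE si) subr_eq0 => /eqP.
have ci := frame_idem cf i.
(* Primitivity applied to d = c_i + (d - c_i), where c_i is not 0. *)
have dci : d = c i.
  case: (dprim (c i) (d - c i)) => //.
  - rewrite /jidempotent !jE [d ** d]dd (jmulC J d (c i)) cd s1 scale1r.
    by rewrite [c i ** c i]ci subrr subr0.
  - by rewrite jBr cd s1 scale1r ci subrr.
  - by rewrite addrC subrK.
  - by move=> ci0; have := frame_neq0 cf i; rewrite ci0 eqxx.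
  - by move/eqP; rewrite subr_eq0 => /eqP.
rewrite (big_nth 0) big_mkord (bigD1 i)//= s1 big1 ?addr0// => j ji.
have := cd j; rewrite {1}dci; have [_ co _] := cf; rewrite co// => /esym/eqP.
by rewrite scaler_eq0 (negbTE (frame_neq0 cf j)) orbF => /eqP.
Qed.

End EuclideanJordanAlgebra.

(** * Finite-dimensional normed spaces *)

Section FiniteDimensionalTopology.
Context {R : realType} {V : normedVectType R}.

Let k := \dim (fullv : {vspace V}).
Let b (i : 'I_k) : V := (vbasis (fullv : {vspace V}))`_i.
Let cv (v : V) : 'rV[R]_k := \row_i coord (vbasis fullv) i v.

Lemma lincomb_cv v : lincomb b (cv v) = v.
Proof.
rewrite [RHS](coord_basis (vbasisP fullv) (memvf v)).
by apply: eq_bigr => i _; rewrite mxE.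
Qed.

Lemma lincomb_eq0 a : lincomb b a = 0 -> a = 0.
Proof.
move=> a0; apply/rowP => i; rewrite mxE.
by have /freeP := basis_free (vbasisP (fullv : {vspace V})); apply.
Qed.

Lemma lincomb_continuous (W : normedModType R) n (c : 'I_n -> W) :
  continuous (lincomb c).
Proof.
apply: continuous_sum_ord => i a.
have ci : continuous (fun x : 'rV[R]_n => x 0 i) by exact: coord_continuous.
exact (continuousZr_tmp (ci a)).
Qed.

Lemma row_norm_ge n (a : 'rV[R]_n) i : `|a 0 i| <= `|a|.
Proof.
rewrite [leRHS]/Num.norm /= mx_normrE; apply/bigmax_geP; right => /=.
by exists (ord0, i).
Qed.

(** [m] is the minimum of [F] on the unit sphere. Used in degree 1 for norms and in degree 2 for
    inner products. *)
Lemma homogeneous_lower_bound n (F : 'rV[R]_n -> R) d :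
  continuous F -> (forall (t : R) a, 0 < t -> F (t *: a) = t ^+ d * F a) ->
  (0 < d)%N -> F 0 = 0 -> (forall a, a != 0 -> 0 < F a) ->
  exists2 m : R, 0 < m & forall a, m * `|a| ^+ d <= F a.
Proof.
move=> cF hF d0 F0 pF; have [n0|n0] := posnP n.
  (* Without coordinates the sphere is empty, but so is the claim, as only a = 0 exists. *)
  exists 1 => // a; have -> : a = 0.
    by apply/rowP => i; have := ltn_ord i; rewrite {2}n0.
  by rewrite normr0 expr0n gtn_eqF// mulr0 F0.
have [c c1 cmin] := @sphere_min R n F n0 (fun x _ => cF x).
exists (F c) => [|a]; first by rewrite pF// -normr_eq0 c1 oner_eq0.
have [->|a0] := eqVneq a 0; first by rewrite normr0 expr0n gtn_eqF// mulr0 F0.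
have na : 0 < `|a| by rewrite normr_gt0.
have /cmin : `| `|a|^-1 *: a| = 1.
  by rewrite normrZ normfV normr_id mulVf// gt_eqF.
rewrite hF ?invr_gt0// exprVn mulrC ler_pdivlMr ?exprn_gt0//.
Qed.

(** The substantial half of the equivalence of norms: coordinates are controlled by the norm of
    [V]. *)
Lemma lincomb_norm_ge : exists2 m : R, 0 < m & forall a, m * `|a| <= `|lincomb b a|.
Proof.
have cF : continuous (fun a => `|lincomb b a|).
  move=> a; apply: continuous_comp; first exact: lincomb_continuous.
  exact: norm_continuous.
have hF (t : R) a : 0 < t -> `|lincomb b (t *: a)| = t ^+ 1 * `|lincomb b a|.
  by move=> t0; rewrite lincombZ normrZ gtr0_norm// expr1.
have F0 : `|lincomb b 0| = 0 by rewrite -(scale0r 0) lincombZ scale0r normr0.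
have pF a : a != 0 -> 0 < `|lincomb b a|.
  by move=> a0; rewrite normr_gt0; apply: contraNneq a0 => /lincomb_eq0 ->.
have [m m0 mP] := homogeneous_lower_bound cF hF isT F0 pF.
by exists m => // a; have := mP a; rewrite expr1.
Qed.

Lemma vect_linear_bound (W : normedModType R) (f : V -> W) : linear f ->
  exists2 C : R, 0 < C & forall v, `|f v| <= C * `|v|.
Proof.
move=> flin; have [m m0 mP] := lincomb_norm_ge.
have fE v : f v = lincomb (f \o b) (cv v).
  pose g : {linear V -> W} := HB.pack_for {linear V -> W} f
    (GRing.isLinear.Build _ _ _ _ f flin).
  rewrite -[f]/(g : V -> W) -{1}(lincomb_cv v) linear_sum.
  by apply: eq_bigr => i _; rewrite linearZ.
(* The added 1 only makes the constant positive. *)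
exists (m^-1 * \sum_i `|f (b i)| + 1) => [|v].
  by rewrite ltr_wpDl// mulr_ge0 ?invr_ge0 ?(ltW m0)// sumr_ge0.
have cvv : `|cv v| <= m^-1 * `|v|.
  by rewrite ler_pdivlMl// -{2}(lincomb_cv v).
rewrite fE (le_trans (ler_norm_sum _ _ _))//.
apply: (@le_trans _ _ (\sum_i `|cv v| * `|f (b i)|)).
  by apply: ler_sum => i _; rewrite normrZ ler_wpM2r// row_norm_ge.
rewrite -mulr_sumr mulrDl mul1r.
apply: (@le_trans _ _ (m^-1 * `|v| * \sum_i `|f (b i)|)).
  by rewrite ler_wpM2r// sumr_ge0.
by rewrite mulrAC lerDl.
Qed.

Lemma vect_linear_continuous (W : normedModType R) (f : V -> W) :
  linear f -> continuous f.
Proof.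
move=> flin; have [C C0 CP] := vect_linear_bound flin.
have fB u v : f (u - v) = f u - f v.
  by rewrite addrC -scaleN1r flin scaleN1r addrC.
move=> x; apply/cvgrPdist_lt => e e0; near=> y.
rewrite -fB (le_lt_trans (CP _))// mulrC -ltr_pdivlMr//.
by near: y; apply: cvgr_dist_lt => //; rewrite divr_gt0.
Unshelve. all: by end_near. Qed.

Lemma vect_bilinear_bound (W : normedModType R) (B : V -> V -> W) :
  (forall u, linear (B u)) -> (forall v, linear (B^~ v)) ->
  exists2 C : R, 0 < C & forall u v, `|B u v| <= C * `|u| * `|v|.
Proof.
move=> Bl Br; have [m m0 mP] := lincomb_norm_ge.
have /choice[C CP] (i : 'I_k) : exists C : R, 0 < C /\ forall v, `|B (b i) v| <= C * `|v|.
  by have [C C0 CP] := vect_linear_bound (Bl (b i)); exists C.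
have BE u v : B u v = lincomb (fun i => B (b i) v) (cv u).
  pose g : {linear V -> W} := HB.pack_for {linear V -> W} (B^~ v)
    (GRing.isLinear.Build _ _ _ _ (B^~ v) (Br v)).
  rewrite -[B u v]/(g u) -{1}(lincomb_cv u) linear_sum.
  by apply: eq_bigr => i _; rewrite linearZ.
have C0 : 0 <= \sum_i C i by apply: sumr_ge0 => i _; have [/ltW] := CP i.
exists (m^-1 * \sum_i C i + 1) => [|u v].
  by rewrite ltr_wpDl// mulr_ge0 ?invr_ge0 ?(ltW m0).
have cvu : `|cv u| <= m^-1 * `|u|.
  by rewrite ler_pdivlMl// -{2}(lincomb_cv u).
rewrite BE (le_trans (ler_norm_sum _ _ _))//.
apply: (@le_trans _ _ (\sum_i `|cv u| * (C i * `|v|))).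
  apply: ler_sum => i _; rewrite normrZ ler_pM ?row_norm_ge//.
  by have [_] := CP i; apply.
rewrite -mulr_sumr -mulr_suml mulrA ler_wpM2r//.
apply: (@le_trans _ _ (m^-1 * `|u| * \sum_i C i)); first by rewrite ler_wpM2r.
by rewrite mulrDl mulrAC mul1r lerDl.
Qed.

(** Heine-Borel for rows, carried over by the continuous coordinate map [lincomb b]. *)
Lemma vect_bounded_closed_compact (A : set V) :
  bounded_set A -> closed A -> compact A.
Proof.
move=> [M [_ AM]] clA; have [m m0 mP] := lincomb_norm_ge.
rewrite (_ : A = lincomb b @` (lincomb b @^-1` A)); last first.
  apply/seteqP; split=> [v Av|_ [a Aa <-]//].
  by exists (cv v); rewrite /preimage /= lincomb_cv.
apply: continuous_compact.
  by apply: continuous_subspaceT; exact: lincomb_continuous.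
apply: bounded_closed_compact; last first.
  by apply: closed_comp => // a _; exact: lincomb_continuous.
exists (m^-1 * (M + 1)); split; first exact: num_real.
move=> N MN a Aa; apply: le_trans (ltW MN); rewrite ler_pdivlMl//.
by rewrite (le_trans (mP a))// AM// ltrDl.
Qed.

Variable dot : {dot V for idfun}.

(** The norm of [V] and the inner product are unrelated, so both are compared with the norm of the
    coordinates. *)
Lemma dot_norm_ge : exists2 m : R, 0 < m & forall v, m * `|v| ^+ 2 <= dot v v.
Proof.
have cF := @dot_lincomb_continuous R V dot k b b.
have hF (t : R) a : 0 < t ->
    dot (lincomb b (t *: a)) (lincomb b (t *: a)) =
    t ^+ 2 * dot (lincomb b a) (lincomb b a).
  by move=> t0; rewrite !lincombZ dotZl dotZr; ring.
have F0 : dot (lincomb b 0) (lincomb b 0) = 0.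
  by rewrite -(scale0r 0) lincombZ scale0r dot0l.
have pF a : a != 0 -> 0 < dot (lincomb b a) (lincomb b a).
  by move=> a0; apply: dot_gt0; apply: contraNneq a0 => /lincomb_eq0 ->.
have [m m0 mP] := homogeneous_lower_bound cF hF isT F0 pF.
have [C C0 CP] : exists2 C : R, 0 < C & forall a, `|lincomb b a| <= C * `|a|.
  exists (\sum_i `|b i| + 1) => [|a]; first by rewrite ltr_wpDl// sumr_ge0.
  rewrite (le_trans (ler_norm_sum _ _ _))//.
  apply: (@le_trans _ _ (\sum_i `|a| * `|b i|)).
    by apply: ler_sum => i _; rewrite normrZ ler_wpM2r// row_norm_ge.
  by rewrite -mulr_sumr mulrC ler_wpM2r// lerDl.
exists (m / C ^+ 2) => [|v]; first by rewrite divr_gt0// exprn_gt0.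
rewrite -(lincomb_cv v) (le_trans _ (mP _))// -mulrA ler_pM2l//.
rewrite ler_pdivrMl ?exprn_gt0// -exprMn.
by rewrite ler_pXn2r ?nnegrE ?mulr_ge0 ?(ltW C0).
Qed.

Lemma dot_bound : exists2 C : R, 0 < C & forall u v, `|dot u v| <= C * `|u| * `|v|.
Proof.
apply: (@vect_bilinear_bound R^o) => [u|v] a x y; first by rewrite dotDr dotZr.
by rewrite dotDl dotZl.
Qed.

End FiniteDimensionalTopology.

(** * Differential calculus *)

Section Calculus.
Context {R : realType} {V : normedVectType R}.
Implicit Types (f : V -> R) (x u v : V).

(** Turns a directional derivative into an ordinary one; the two difference quotients are the same
    function. *)
Lemma is_derive_line f x u t : derivable f (x + t *: u) u ->
  is_derive t (1 : R) (fun s => f (x + s *: u)) ('D_u f (x + t *: u)).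
Proof.
move=> fu.
have E : (fun h : R => h^-1 *: (((fun s => f (x + s *: u)) \o shift t) (h *: 1) -
    f (x + t *: u))) =
    (fun h => h^-1 *: ((f \o shift (x + t *: u)) (h *: u) - f (x + t *: u))).
  apply/funext => h /=; rewrite /shift /=; congr (_ *: (f _ - _)).
  by rewrite (_ : h *: 1 = h) ?scalerDl 1?addrCA//; exact: mulr1.
by split; [rewrite /derivable E|rewrite /derive E].
Qed.

Lemma derive_approx f x u : derivable f x u -> forall e : R, 0 < e ->
  exists2 d : R, 0 < d & forall h : R, h != 0 -> `|h| < d ->
    `|'D_u f x - h^-1 * (f (x + h *: u) - f x)| < e.
Proof.
move=> fu e e0; have := fu; rewrite /derivable -/('D_u f x).
move=> /cvgrPdist_lt/(_ e e0)[d /= d0 dP].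
exists d => // h h0 hd; have := dP h; rewrite /= /ball_ /= sub0r normrN.
by rewrite /shift /= (addrC (h *: u)); apply.
Qed.

(** [p] and [q] stand for the difference quotients at h and at -h in [derive_touching]. *)
Lemma two_sided_approx (D b k p q : R) : k <= `|D - b| / 2 ->
  b - k <= p -> q <= b + k -> `|D - p| < `|D - b| / 2 ->
  `|D - q| < `|D - b| / 2 -> False.
Proof.
rewrite !ltr_norml => hk hp hq /andP[p1 p2] /andP[q1 q2].
have [Db|Db] := lerP 0 (D - b).
  by rewrite (ger0_norm Db) in hk p1 p2 q1 q2; lra.
by rewrite (ltr0_norm Db) in hk p1 p2 q1 q2; lra.
Qed.

(** A parabola touching from below bounds the quotients at h > 0 from below and those at -h from
    above, which pins down the slope. This yields the first-order conditions at all the minima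
    considered later. *)
Lemma derive_touching f x u (b K d : R) : derivable f x u -> 0 < d ->
  (forall h, `|h| < d -> f x + h * b - K * h ^+ 2 <= f (x + h *: u)) ->
  'D_u f x = b.
Proof.
move=> fu d0 touch; apply/eqP; rewrite -subr_eq0 -normr_le0.
rewrite leNgt; apply/negP => e0.
set D := 'D_u f x in e0 *.
have [r r0 rP] := derive_approx fu (divr_gt0 e0 (ltr0n _ 2)).
have K1 : 0 < `|K| + 1 by rewrite ltr_wpDl.
(* Small enough for the bound, for the approximation [rP], and for |K| h to be at most half of the
   supposed error. *)
pose h := Num.min (Num.min (d / 2) (r / 2)) (`|D - b| / (2 * (`|K| + 1))).
have h0 : 0 < h by rewrite !lt_min !divr_gt0// mulr_gt0.
have hd : h < d.
  by rewrite !gt_min ltr_pdivrMr// mulr_natr mulr2n ltrDl d0.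
have hr : h < r.
  by rewrite !gt_min [r / 2 < r]ltr_pdivrMr// mulr_natr mulr2n ltrDl r0 orbT.
have hK : `|K| * h <= `|D - b| / 2.
  apply: (@le_trans _ _ ((`|K| + 1) * h)); first by rewrite ler_pM2r// lerDl.
  rewrite -ler_pdivlMl// mulrC -mulrA -invfM.
  by rewrite /h ge_min lexx orbT.
have nh : `|h| = h by rewrite gtr0_norm.
have hn0 : h != 0 by rewrite gt_eqF.
have q1 : b - K * h <= h^-1 * (f (x + h *: u) - f x).
  rewrite ler_pdivlMl//; have := touch h; rewrite nh => /(_ hd) t1.
  by rewrite lerBrDl (le_trans _ t1)// le_eqVlt; apply/orP; left; apply/eqP; ring.
have q2 : (- h)^-1 * (f (x + (- h) *: u) - f x) <= b + K * h.
  rewrite invrN mulNr lerNl ler_pdivlMl//.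
  have := touch (- h); rewrite normrN nh => /(_ hd) t1.
  by rewrite lerBrDl (le_trans _ t1)// le_eqVlt; apply/orP; left; apply/eqP; ring.
have := rP h hn0; rewrite nh => /(_ hr); rewrite -/D => p1.
have := rP (- h); rewrite oppr_eq0 normrN nh => /(_ hn0 hr); rewrite -/D => p2.
have hK' : K * h <= `|D - b| / 2.
  by rewrite (le_trans _ hK)// ler_pM2r// ler_norm.
exact: (two_sided_approx hK' q1 q2 p1 p2).
Qed.

Lemma derive_linear f x : differentiable f x -> forall (a : R) u v,
  'D_(a *: u + v) f x = a * 'D_u f x + 'D_v f x.
Proof. by move=> fx a u v; rewrite !deriveE// linearP. Qed.

(** With v = 0 this is a segment around [x], the usual way of staying inside the open cone. *)
Lemma nbhs_parallelogram x u v (P : set V) : nbhs x P ->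
  exists2 d : R, 0 < d & forall s t : R, `|s| <= d -> `|t| <= d -> P (x + s *: u + t *: v).
Proof.
move=> /nbhs_normP[r /= r0 rP].
pose c := `|u| + `|v| + 1.
have c0 : 0 < c by rewrite ltr_wpDl// addr_ge0.
exists (r / (c * 2)) => [|s t sd td]; first by rewrite divr_gt0// mulr_gt0.
apply: rP => /=; rewrite -addrA opprD addrA subrr sub0r normrN.
rewrite (le_lt_trans (ler_normD _ _))// !normrZ.
apply: (@le_lt_trans _ _ (r / (c * 2) * (`|u| + `|v|))).
  by rewrite mulrDr lerD// ler_wpM2r.
apply: (@le_lt_trans _ _ (r / (c * 2) * c)).
  by rewrite ler_pM2l ?divr_gt0 ?mulr_gt0// /c lerDl.
rewrite invfM mulrA mulrAC mulfVK ?gt_eqF// ltr_pdivrMr// mulr_natr mulr2n.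
by rewrite ltrDl.
Qed.

(** The mean value theorem twice: in [r] for the difference of [f] along two parallel sides, then in
    [s] for ['D_u f]. *)
Lemma second_difference f x u v (t : R) : 0 < t ->
  (forall r s : R, 0 <= r <= t -> 0 <= s <= t ->
    [/\ derivable f (x + r *: u + s *: v) u &
        derivable ('D_u f) (x + r *: u + s *: v) v]) ->
  exists r s : R, [/\ 0 <= r <= t, 0 <= s <= t &
    f (x + t *: u + t *: v) - f (x + t *: u) - (f (x + t *: v) - f x) =
    'D_v ('D_u f) (x + r *: u + s *: v) * t ^+ 2].
Proof.
move=> t0 D.
have t0t : 0 <= t <= t by rewrite ltW/=.
have z0t : (0 : R) <= 0 <= t by rewrite lexx ltW.
pose phi r := f (x + t *: v + r *: u) - f (x + r *: u).
pose dphi r := 'D_u f (x + t *: v + r *: u) - 'D_u f (x + r *: u).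
have dphiP r : 0 <= r <= t -> is_derive r (1 : R) phi (dphi r).
  move=> rt; apply: is_deriveB; apply: is_derive_line.
    by rewrite addrAC; have [] := D r t rt t0t.
  by have [] := D r 0 rt z0t; rewrite scale0r addr0.
have [||r rt phiE] := @MVT R phi dphi 0 t t0.
- move=> r; rewrite in_itv /= => /andP[r0 r1].
  by apply: dphiP; rewrite !ltW.
- apply: derivable_within_continuous => r; rewrite in_itv /= => rt.
  by have [] := dphiP r rt.
have {}rt : 0 <= r <= t by move: rt; rewrite in_itv /= => /andP[/ltW-> /ltW->].
pose psi s := 'D_u f (x + r *: u + s *: v).
have dpsiP s : 0 <= s <= t ->
    is_derive s (1 : R) psi ('D_v ('D_u f) (x + r *: u + s *: v)).
  by move=> st; apply: is_derive_line; have [] := D r s rt st.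
have [||s st psiE] := @MVT R psi (fun s => 'D_v ('D_u f) (x + r *: u + s *: v)) 0 t t0.
- move=> s; rewrite in_itv /= => /andP[s0 s1].
  by apply: dpsiP; rewrite !ltW.
- apply: derivable_within_continuous => s; rewrite in_itv /= => st.
  by have [] := dpsiP s st.
have {}st : 0 <= s <= t by move: st; rewrite in_itv /= => /andP[/ltW-> /ltW->].
exists r, s; split => //.
move: phiE psiE; rewrite /phi /dphi /psi !scale0r !addr0 !subr0 => E1 E2.
rewrite (addrAC x (t *: v) (t *: u)) (addrAC x (t *: v) (r *: u)) in E1.
by rewrite expr2 mulrA -E2 -E1; ring.
Qed.

Lemma half_distance_disjoint (a b c : R) :
  `|a - c| < `|a - b| / 2 -> `|b - c| < `|a - b| / 2 -> False.
Proof. by move=> ac bc; have := ler_distD c a b; rewrite (distrC c b); lra. Qed.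

(** The second difference is symmetric in [u] and [v], so the two mixed derivatives share a value at
    points as close to [x] as desired; continuity concludes. *)
Lemma schwarz f x u v (O : set V) : open O -> O x ->
  (forall y, O y -> derivable f y u /\ derivable f y v) ->
  (forall y, O y -> derivable ('D_u f) y v /\ derivable ('D_v f) y u) ->
  {for x, continuous ('D_v ('D_u f))} -> {for x, continuous ('D_u ('D_v f))} ->
  'D_v ('D_u f) x = 'D_u ('D_v f) x.
Proof.
move=> oO Ox D1 D2 c1 c2; apply/eqP/negPn/negP => ne.
have e0 : 0 < `|'D_v ('D_u f) x - 'D_u ('D_v f) x| / 2.
  by rewrite divr_gt0// normr_gt0 subr_eq0.
have /cvgrPdist_lt/(_ _ e0) n1 := c1.
have /cvgrPdist_lt/(_ _ e0) n2 := c2.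
have nO : nbhs x O by apply: open_nbhs_nbhs.
have [d1 d10 d1P] := nbhs_parallelogram u v (filterI nO (filterI n1 n2)).
have [d2 d20 d2P] := nbhs_parallelogram v u (filterI nO (filterI n1 n2)).
pose t := Num.min d1 d2.
have t0 : 0 < t by rewrite lt_min d10.
have le1 (r : R) : 0 <= r <= t -> `|r| <= d1.
  by move=> /andP[r0 rt]; rewrite ger0_norm// (le_trans rt)// ge_min lexx.
have le2 (r : R) : 0 <= r <= t -> `|r| <= d2.
  by move=> /andP[r0 rt]; rewrite ger0_norm// (le_trans rt)// ge_min lexx orbT.
have [|r [s [rt st E1]]] := @second_difference f x u v t t0.
  move=> r s rt st; have [Oy _] := d1P r s (le1 _ rt) (le1 _ st).
  by split; [have [] := D1 _ Oy|have [] := D2 _ Oy].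
have [|r' [s' [rt' st' E2]]] := @second_difference f x v u t t0.
  move=> r' s' rt' st'; have [Oy _] := d2P r' s' (le2 _ rt') (le2 _ st').
  by split; [have [] := D1 _ Oy|have [] := D2 _ Oy].
have [_ [/= h1 _]] := d1P r s (le1 _ rt) (le1 _ st).
have [_ [/= _ h2]] := d2P r' s' (le2 _ rt') (le2 _ st').
have EE : 'D_v ('D_u f) (x + r *: u + s *: v) = 'D_u ('D_v f) (x + r' *: v + s' *: u).
  have t2 : t ^+ 2 != 0 by rewrite expf_neq0// gt_eqF.
  have swap (p q r0 s0 : R) : p - q - (r0 - s0) = p - r0 - (q - s0) by ring.
  have E12 : f (x + t *: u + t *: v) - f (x + t *: u) - (f (x + t *: v) - f x) =
      f (x + t *: v + t *: u) - f (x + t *: v) - (f (x + t *: u) - f x).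
    by rewrite (addrAC x (t *: v)) swap.
  exact: (mulIf t2 (etrans (esym E1) (etrans E12 E2))).
rewrite EE in h1; exact: half_distance_disjoint h1 h2.
Qed.

(** By convexity the difference quotients with 0 < t <= 1 are at most f y - f x. *)
Lemma convex_gradient_le (O : set V) f x y :
  convex_function (O : set (convex_lmodType V)) f -> O x -> O y ->
  derivable f x (y - x) -> f x + 'D_(y - x) f x <= f y.
Proof.
move=> cf Ox Oy fxy; rewrite leNgt; apply/negP => lt.
have e0 : 0 < f x + 'D_(y - x) f x - f y by rewrite subr_gt0.
have [d d0 dP] := derive_approx fxy e0.
pose t := Num.min (d / 2) 1.
have t0 : 0 < t by rewrite lt_min divr_gt0//=.
have t1 : t <= 1 by rewrite ge_min lexx orbT.
have td : `|t| < d.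
  by rewrite gtr0_norm// gt_min ltr_pdivrMr// mulr_natr mulr2n ltrDl d0.
have := dP t (lt0r_neq0 t0) td; apply/negP; rewrite -leNgt.
pose ti : {i01 R} := Itv01 (ltW t0) t1.
have cvx : f (t *: y + (1 - t) *: x) <= t * f y + (1 - t) * f x.
  exact: (cf ti y x (mem_set Oy) (mem_set Ox)).
have E : t *: y + (1 - t) *: x = x + t *: (y - x).
  by rewrite scalerBl scale1r scalerBr addrCA.
rewrite E in cvx; apply: le_trans (ler_norm _).
have q : t^-1 * (f (x + t *: (y - x)) - f x) <= f y - f x.
  by rewrite ler_pdivrMl//; lra.
by rewrite -addrA [leLHS]addrC -addrA lerD2l; lra.
Qed.

(** Used for [H], with c = 1 and d = - nu ln t, and for its first derivatives, with c = 1 / t and d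
    = 0. *)
Lemma derive_scale (O : set V) f x u t c d : open O -> O x -> 0 < t ->
  (forall y, O y -> f (t *: y) = c * f y + d) ->
  differentiable f (t *: x) -> differentiable f x ->
  t * 'D_u f (t *: x) = c * 'D_u f x.
Proof.
move=> oO Ox t0 fE dft dfx.
have E : t * 'D_u f (t *: x) = 'D_(t *: u) f (t *: x).
  by rewrite !deriveE// linearZ.
have h1 : is_derive (0 : R) (1 : R) (fun s => f (t *: x + s *: (t *: u)))
    ('D_(t *: u) f (t *: x)).
  have := @is_derive_line f (t *: x) (t *: u) 0.
  by rewrite scale0r addr0; apply; exact: diff_derivable.
have h2 : is_derive (0 : R) (1 : R) (fun s => c * f (x + s *: u) + d)
    (c * 'D_u f x).
  have h : is_derive (0 : R) (1 : R) (fun s => f (x + s *: u)) ('D_u f x).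
    have := @is_derive_line f x u 0.
    by rewrite scale0r addr0; apply; exact: diff_derivable.
  have := is_deriveD (is_deriveZ c h) (is_derive_cst d (0 : R) 1).
  by rewrite addr0.
rewrite E; have [_ <-] := h1; have [_ <-] := h2.
apply: near_eq_derive.
have [r r0 rP] := nbhs_parallelogram u 0 (open_nbhs_nbhs (conj oO Ox)).
near=> s.
have -> : t *: x + s *: (t *: u) = t *: (x + s *: u).
  by rewrite scalerDr !scalerA mulrC.
rewrite fE//.
have := rP s 0; rewrite scaler0 addr0; apply; last by rewrite normr0 ltW.
near: s; apply/nbhs_ballP; exists r => //= z.
by rewrite /ball /= sub0r normrN => /ltW.
Unshelve. all: by end_near. Qed.

(** Differentiate t |-> f (t x) at t = 1. *)
Lemma euler (O : set V) f x c c' : O x ->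
  (forall t, 0 < t -> f (t *: x) = c t * f x) ->
  is_derive (1 : R) (1 : R) c c' -> differentiable f x -> 'D_x f x = c' * f x.
Proof.
move=> Ox fE cc dfx.
have h1 : is_derive (1 : R) (1 : R) (fun s => f (0 + s *: x)) ('D_x f x).
  have := @is_derive_line f 0 x 1.
  by rewrite scale1r add0r; apply; exact: diff_derivable.
have h2 : is_derive (1 : R) (1 : R) (fun s => f x * c s) (f x * c').
  exact: (is_deriveZ (f x) cc).
have [_ <-] := h1; rewrite mulrC; have [_ <-] := h2.
apply: near_eq_derive; near=> s; rewrite add0r fE 1?mulrC//.
by near: s; exact: lt_nbhsr.
Unshelve. all: by end_near. Qed.

End Calculus.

(** * Riesz representation and self-adjoint maps with spectrum {1} *)

Section Riesz.
Context {R : realType} {V : vectType R}.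
Variable dot : {dot V for idfun}.

Lemma scalar_sum (phi : V -> R) n (c : 'I_n -> R) (b : 'I_n -> V) :
  (forall (a : R) u v, phi (a *: u + v) = a * phi u + phi v) ->
  phi (\sum_(i < n) c i *: b i) = \sum_i c i * phi (b i).
Proof.
move=> philin; have phi0 : phi 0 = 0.
  by have := philin (- 1) 0 0; rewrite scaler0 addr0 mulN1r addNr.
elim/big_ind2: _ => // [x x' y y' <- <-|i _].
  by rewrite -(scale1r x') philin mul1r scale1r.
by rewrite -[X in phi X]addr0 philin phi0 addr0.
Qed.

(** The map sending [w] to its products with a basis is injective, hence onto by dimension. *)
Lemma riesz (phi : V -> R) :
  (forall (a : R) u v, phi (a *: u + v) = a * phi u + phi v) ->
  exists w, forall v, dot w v = phi v.
Proof.
move=> philin; pose n := \dim (fullv : {vspace V}).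
pose b (i : 'I_n) : V := (vbasis fullv)`_i.
have coordE v : v = \sum_(i < n) coord (vbasis fullv) i v *: b i.
  exact: (coord_basis (vbasisP fullv) (memvf v)).
pose F (w : V) : 'rV[R]_n := \row_i dot w (b i).
have Flin : linear F.
  by move=> a u v; apply/rowP => i; rewrite !mxE dotDl dotZl.
pose g : {linear V -> 'rV[R]_n} := HB.pack_for {linear V -> 'rV[R]_n} F
  (GRing.isLinear.Build _ _ _ _ F Flin).
have gker : lker (linfun g) = 0%VS.
  apply/eqP; rewrite -subv0; apply/subvP => u; rewrite memv_ker memv0 lfunE /=.
  move=> /eqP/rowP u0; apply/eqP/(dot_eq0 (dot := dot)).
  rewrite {2}(coordE u) linear_sumr big1// => i _.
  have ui : dot u (b i) = 0 by have := u0 i; rewrite !mxE.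
  by apply: etrans (dotZr _ _ _ _) _; rewrite ui mulr0.
have gfull : limg (linfun g) = fullv.
  have dimn : \dim (fullv : {vspace 'rV[R]_n}) = n by rewrite dimvf /dim /= mul1n.
  by apply/eqP; rewrite eqEdim subvf limg_dim_eq ?gker ?capv0// dimn /=.
have : (\row_i phi (b i) : 'rV[R]_n) \in limg (linfun g) by rewrite gfull memvf.
move=> /memv_imgP[w _ wE]; exists w => v.
rewrite (coordE v) linear_sumr scalar_sum//; apply: eq_bigr => i _.
have /rowP/(_ i) := wE; rewrite lfunE /= !mxE => ->.
exact: dotZr.
Qed.

(** The least eigenvalues of [f] and of - f are 1 and -1, so the quadratic form of [f] is squeezed
    between <y, y> and itself; polarize. *)
Lemma selfadjoint_unit_spectrum (f : V -> V) : linear f ->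
  (forall u w, dot (f u) w = dot u (f w)) ->
  (forall u (l : R), u != 0 -> f u = l *: u -> l = 1) ->
  forall u w, dot (f u) w = dot u w.
Proof.
move=> flin fsa f1.
have [fV0|fV0] := eqVneq (fullv : {vspace V}) 0%VS.
  move=> u w; have -> : w = 0 by apply/eqP; rewrite -memv0 -fV0 memvf.
  by rewrite !dot0r.
have gen (g : V -> V) : linear g -> (forall u w, dot (g u) w = dot u (g w)) ->
    exists2 z, z != 0 & exists2 l : R, g z = l *: z &
    forall w, l * dot w w <= dot (g w) w.
  move=> glin gsa; pose h : {linear V -> V} := HB.pack_for {linear V -> V} g
    (GRing.isLinear.Build _ _ _ _ g glin).
  have [z [_ z0] [l zl lP]] := @selfadjoint_eigenvector _ _ dot h fullv
    (fun _ _ => memvf _) gsa fV0.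
  by exists z => //; exists l => // y; apply: lP; exact: memvf.
have [z1 z10 [l1 z1E l1P]] := gen f flin fsa.
have Nlin : linear (fun u => - f u).
  by move=> a x y; rewrite flin opprD scalerN.
have Nsa u w : dot (- f u) w = dot u (- f w) by rewrite dotNl dotNr fsa.
have [z2 z20 [l2 z2E l2P]] := gen _ Nlin Nsa.
have l11 := f1 _ _ z10 z1E.
have l21 : - l2 = 1 by apply: (f1 _ _ z20); rewrite scaleNr -z2E opprK.
have fE y : dot (f y) y = dot y y.
  have := l1P y; have := l2P y; rewrite dotNl l11.
  have -> : l2 = - 1 by rewrite -l21 opprK.
  lra.
move=> u w; have := fE (u + w); have := fE u; have := fE w.
have -> : f (u + w) = f u + f w by rewrite -[u in LHS]scale1r flin scale1r.
rewrite !(dotE dot) (dotC _ w u) (dotC _ (f w) u) -fsa; lra.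
Qed.

End Riesz.

(** * The symmetric cone *)

Section SymmetricCone.
Context {R : realType} {V : normedVectType R}.
Variable J : euclideanJordanAlgebra V.
Local Notation "x ** y" := (jmul J x y) (at level 40, left associativity).
Local Notation "''[' x , y ]" := (jdot J x y).
Local Notation e := (jone J).
Local Notation Omega := (symmetric_cone J).

Lemma cvg_sum_ord (T : Type) (F : set_system T) (FF : Filter F)
    (W : normedModType R) n (f : 'I_n -> T -> W) (a : 'I_n -> W) :
  (forall i, f i x @[x --> F] --> a i) ->
  (\sum_(i < n) f i x) @[x --> F] --> \sum_(i < n) a i.
Proof.
move=> fa; rewrite (_ : (fun x => _) = \sum_(i < n) f i); last first.
  by apply/funext => x; rewrite fct_sumE.
elim/big_ind2: _ => [|x x' y y' xx yy|i _]; last exact: fa.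
- exact: cvg_cst.
- exact: (cvgD xx yy).
Qed.

Lemma jexp_frame r (c : 'I_r -> V) (l : 'I_r -> R) : jordan_frame J c ->
  jexp J (\sum_j l j *: c j) = \sum_j expR (l j) *: c j.
Proof.
move=> cf; rewrite /jexp; apply: cvg_lim; first exact: norm_hausdorff.
rewrite (_ : series _ = fun n => \sum_j series (exp_coeff (l j)) n *: c j).
  apply: cvg_sum_ord => j; apply: cvgZr_tmp.
  exact: is_cvg_series_exp_coeff.
apply/funext => n; rewrite /series /=.
under eq_bigr do rewrite (frame_pow cf) scaler_sumr.
rewrite exchange_big /=; apply: eq_bigr => j _.
rewrite scaler_suml; apply: eq_bigr => m _.
by rewrite scalerA /exp_coeff /= mulrC.
Qed.

Lemma omegaP x : Omega x <-> exists r (c : 'I_r -> V) (l : 'I_r -> R),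
  [/\ jordan_frame J c, forall i, 0 < l i & x = \sum_i l i *: c i].
Proof.
split=> [[y _ <-]|[r [c [l [cf l0 ->]]]]].
  have [r [c [l [cf ->]]]] := spectral_theorem J y.
  exists r, c, (fun i => expR (l i)); split => // [i|]; first exact: expR_gt0.
  exact: jexp_frame.
exists (\sum_i ln (l i) *: c i) => //; rewrite jexp_frame//.
by apply: eq_bigr => i _; rewrite lnK// posrE.
Qed.

(** Positive definiteness of [L(x)]: no frame occurs, and convexity and homogeneity become
    immediate. *)
Lemma omega_posP x : Omega x <-> forall u, u != 0 -> 0 < '[x ** u, u].
Proof.
split=> [/omegaP[r [c [l [cf l0 ->]]]]|pos]; first exact/frame_posP.
have [r [c [l [cf xE]]]] := spectral_theorem J x.
by apply/omegaP; exists r, c, l; split => //; apply/(frame_posP cf); rewrite -xE.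
Qed.

Lemma omegaZ (t : R) x : 0 < t -> Omega x -> Omega (t *: x).
Proof.
move=> t0 /omega_posP xp; apply/omega_posP => u u0.
by rewrite jZl dotZl mulr_gt0 ?xp.
Qed.

Lemma omega_segment (t : R) x y : 0 <= t <= 1 -> Omega x -> Omega y ->
  Omega (x + t *: (y - x)).
Proof.
move=> /andP[t0 t1] /omega_posP xp /omega_posP yp; apply/omega_posP => u u0.
rewrite !(jE, dotE); have := xp u u0; have := yp u u0; nra.
Qed.

Lemma omega1 : Omega e.
Proof. by apply/omega_posP => u u0; rewrite jmul1 dot_gt0. Qed.

Lemma omega_idempotentD (t : R) c : jidempotent J c -> 0 < t ->
  Omega (c + t *: e).
Proof.
move=> cc t0; apply/omega_posP => u u0.
rewrite jDl jZl jmul1 dotDl dotZl ltr_wpDl ?idempotent_ge0//.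
by rewrite mulr_gt0// dot_gt0.
Qed.

Lemma omega_dot_idempotent_gt0 x c : Omega x -> jidempotent J c -> c != 0 ->
  0 < '[x, c].
Proof.
move=> /omega_posP xp cc c0; have <- : '[x ** c, c] = '[x, c].
  by rewrite (jmulC J x) jdot_sa [c ** c]cc.
exact: xp.
Qed.

Lemma omega_dot_gt0 x y : e != 0 -> Omega x -> Omega y -> 0 < '[x, y].
Proof.
move=> e0 /omegaP[r [c [l [cf l0 ->]]]] Oy.
(* An empty frame would give e = 0. *)
case: r c l cf l0 => [|r] c l cf l0.
  by have [_ _] := cf; rewrite big_ord0 => e00; rewrite e00 eqxx in e0.
rewrite linear_sumlz (bigD1 ord0)//= dotZl ltr_pwDl//.
  rewrite mulr_gt0// dotC omega_dot_idempotent_gt0 ?(frame_neq0 cf)//.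
  exact: (frame_idem cf).
apply: sumr_ge0 => i _; rewrite dotZl mulr_ge0 ?(ltW (l0 _))// dotC.
rewrite ltW// omega_dot_idempotent_gt0 ?(frame_neq0 cf)//.
exact: (frame_idem cf).
Qed.

(** Once x - t e is in the cone, [L(x)] exceeds t; a perturbation of [x] smaller than t m / (C D)
    changes its quadratic form by at most t <u, u>. *)
Lemma omega_open : open Omega.
Proof.
rewrite openE => x Ox.
have [r [c [l [cf l0 xE]]]] := (omegaP x).1 Ox.
have [t t0 xt] : exists2 t : R, 0 < t & Omega (x - t *: e).
  (* Starting the minimum at 1 covers an empty frame. *)
  pose t := (\big[Num.min/1]_i l i) / 2.
  have m0 : 0 < \big[Num.min/1]_i l i.
    by elim/big_ind: _ => // a b a0 b0; rewrite lt_min a0.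
  exists t; first by rewrite divr_gt0.
  apply/omegaP; exists r, c, (fun i => l i - t); split => // [i|].
    have mi : \big[Num.min/1]_j l j <= l i by exact: bigmin_le_cond.
    rewrite subr_gt0 (lt_le_trans _ mi)//.
    by rewrite /t ltr_pdivrMr// mulr_natr mulr2n ltrDl.
  have [_ _ <-] := cf; rewrite xE scaler_sumr -sumrB.
  by apply: eq_bigr => i _; rewrite scalerBl.
have [C C0 CP] := @vect_bilinear_bound R V R^o (fun z u => '[z, u])
  (fun u a v w => etrans (dotDr _ _ _ _) (congr1 (+%R^~ _) (dotZr _ _ _ _)))
  (fun v a u w => etrans (dotDl _ _ _ _) (congr1 (+%R^~ _) (dotZl _ _ _ _))).
have [D D0 DP] := @vect_bilinear_bound R V V (fun z u => z ** u)
  (fun u a v w => etrans (jDr _ _ _ _) (congr1 (+%R^~ _) (jZr _ _ _ _)))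
  (fun v a u w => etrans (jDl _ _ _ _) (congr1 (+%R^~ _) (jZl _ _ _ _))).
have [m m0 mP] := dot_norm_ge (jdot J).
have d0 : 0 < t * m / (C * D) by rewrite !divr_gt0 ?mulr_gt0.
apply/nbhs_normP; exists (t * m / (C * D)) => //= y /= xy.
apply/omega_posP => u u0.
have := (omega_posP _).1 xt u u0; rewrite jBl jZl jmul1 dotBl dotZl.
have -> : y = x - (x - y) by rewrite subKr.
rewrite jBl dotBl => xu.
have h1 : '[(x - y) ** u, u] <= t * '[u, u].
  rewrite (le_trans (ler_norm _))// (le_trans (CP _ _))//.
  apply: (@le_trans _ _ (C * (D * `|x - y| * `|u|) * `|u|)).
    by rewrite ler_wpM2r// ler_wpM2l ?(ltW C0).
  apply: (@le_trans _ _ (t * (m * `|u| ^+ 2))); last by rewrite ler_wpM2l ?(ltW t0).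
  have -> : C * (D * `|x - y| * `|u|) * `|u| = (C * D * `|x - y|) * `|u| ^+ 2 by ring.
  rewrite mulrA ler_wpM2r ?sqr_ge0//.
  by have := ltW xy; rewrite ler_pdivlMr ?mulr_gt0// mulrC.
lra.
Qed.

Lemma affine_ge0 (a b : R) : (forall t, 0 < t -> 0 <= a + t * b) -> 0 <= a.
Proof.
move=> h; rewrite leNgt; apply/negP => a0.
have b1 : 0 < `|b| + 1 by rewrite ltr_wpDl.
pose t := - a / (2 * (`|b| + 1)).
have t0 : 0 < t by rewrite divr_gt0 ?oppr_gt0 ?mulr_gt0.
have := h t t0; rewrite leNgt => /negP; apply.
apply: (@le_lt_trans _ _ (a + t * (`|b| + 1))).
  by rewrite lerD2l ler_pM2l// (le_trans (ler_norm b))// lerDl.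
have -> : t * (`|b| + 1) = - a / 2 by rewrite /t; field; rewrite gt_eqF.
lra.
Qed.

(** Self-duality with a margin: testing on the frame idempotents of [s], as limits of points of the
    cone, shows each eigenvalue to be at least [t]. *)
Lemma omega_dual s (t : R) : 0 < t ->
  (forall x, Omega x -> 0 <= '[x, s - t *: e]) -> Omega s.
Proof.
move=> t0 pos; have [r [c [l [cf sE]]]] := spectral_theorem J s.
apply/omegaP; exists r, c, l; split => // i.
have cc := frame_idem cf i.
have ci0 : 0 < '[c i, c i] by rewrite dot_gt0// (frame_neq0 cf).
have : 0 <= '[c i, s - t *: e].
  apply: (@affine_ge0 _ '[e, s - t *: e]) => d d0.
  by rewrite -dotZl -dotDl; exact/pos/omega_idempotentD.
have ce : '[c i, e] = '[c i, c i] by rewrite -[c i in LHS]cc jdot1.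
have cs : '[c i, s] = l i * '[c i, c i].
  have -> : '[c i, s] = '[c i, c i ** s] by rewrite -jdot_sa cc.
  by rewrite sE (frame_mul cf) dotZr.
rewrite dotBr dotZr ce cs -mulrBl pmulr_lge0// subr_ge0; exact: lt_le_trans.
Qed.

Lemma jmul_quadratic_eq0 u : (forall w, '[u ** w, w] = 0) -> u = 0.
Proof.
move=> u0; have [r [c [l [cf uE]]]] := spectral_theorem J u.
rewrite uE big1// => i _; have := u0 (c i).
rewrite uE jmulC (frame_mul cf) dotZl => /eqP.
by rewrite mulf_eq0 (gt_eqF (dot_gt0 _ (frame_neq0 cf i))) orbF => /eqP->;
  rewrite scale0r.
Qed.

(** In a frame, B(c_j, c_j) is B(e, c_j) minus terms with orthogonal arguments, hence 0. So B(x, x)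
    = 0 by the spectral theorem; polarize. *)
Lemma frame_form_eq0 (B : V -> V -> R) :
  (forall x, forall (a : R) u w, B x (a *: u + w) = a * B x u + B x w) ->
  (forall x y, B x y = B y x) -> (forall x, B e x = 0) ->
  (forall c d, jidempotent J c -> jidempotent J d -> c ** d = 0 -> B c d = 0) ->
  forall x y, B x y = 0.
Proof.
move=> Blin Bsym B1 Bcd.
have Bxx x : B x x = 0.
  have [r [c [l [cf ->]]]] := spectral_theorem J x.
  have Bij i j : B (c i) (c j) = 0.
    have Bne i' j' : i' != j' -> B (c i') (c j') = 0.
      move=> ij; apply: Bcd; try exact: (frame_idem cf).
      by have [_ co _] := cf; exact: co.
    have [->|] := eqVneq i j; last exact: Bne.
    have := B1 (c j); have [_ _ <-] := cf.
    rewrite Bsym; under eq_bigr do rewrite -[c _]scale1r.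
    rewrite scalar_sum// (bigD1 j)//= big1 => [|k kj]; first by rewrite mul1r addr0.
    by rewrite Bne ?mulr0// eq_sym.
  rewrite scalar_sum// big1// => i _.
  by rewrite Bsym scalar_sum// big1 ?mulr0// => j _; rewrite Bij mulr0.
move=> x y; have := Bxx (x + y).
have BD z u w : B z (u + w) = B z u + B z w by rewrite -[u in LHS]scale1r Blin mul1r.
rewrite BD (Bsym _ x) (Bsym _ y) !BD !Bxx (Bsym y x); lra.
Qed.

(** The cone contains no line: otherwise <u w, w> would vanish for every [w]. *)
Lemma omega_exit_side x u : u != 0 ->
  exists t : R, ~ Omega (x + t *: u).
Proof.
move=> u0; apply: contrapT => nex.
have all t : Omega (x + t *: u) by apply: contrapT => h; apply: nex; exists t.
move/eqP: u0; apply; apply: jmul_quadratic_eq0 => w.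
have [->|w0] := eqVneq w 0; first by rewrite j0r dot0l.
apply: (@quadratic_linear_coef_eq0 R _ 0) => t.
rewrite mul0r addr0; apply: (@affine_ge0 _ '[x ** w, w]) => d d0.
have := (omega_posP _).1 (all (d^-1 * t)) w w0.
rewrite jDl jZl dotDl dotZl => /ltW h.
have := mulr_ge0 (ltW d0) h; rewrite mulrDr addrC !mulrA divff ?gt_eqF//.
by rewrite mul1r (mulrC t).
Qed.

(** [t0] is [t1] times the supremum of the [s] with x + s t1 u in the cone; openness keeps the
    endpoint out. A ray may leave the cone on one side only, so [t0] can be negative. *)
Lemma omega_exit_time x u : Omega x -> u != 0 ->
  exists2 t0 : R, t0 != 0 & ~ Omega (x + t0 *: u) /\
    forall s, 0 <= s < 1 -> Omega (x + (s * t0) *: u).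
Proof.
move=> Ox u0; have [t1 nt1] := omega_exit_side x u0.
pose S := [set s : R | 0 <= s /\ Omega (x + (s * t1) *: u)].
have S0 : S 0 by split => //; rewrite mul0r scale0r addr0.
have Sdown (s s' : R) : S s -> 0 <= s' <= s -> S s'.
  move=> [s0 Os] /andP[s'0 s's]; split => //.
  have [s'E|ss'] := eqVneq s 0.
    by have -> : s' = s by apply: le_anti; rewrite s's s'E.
  have sp : 0 < s by rewrite lt_neqAle eq_sym ss'.
  have := @omega_segment (s' / s) _ _ _ Ox Os.
  rewrite ler_pdivlMr// mul0r ler_pdivrMr// mul1r s'0 s's => /(_ isT).
  rewrite [x + _ - x]addrAC subrr add0r scalerA mulrA divfK ?gt_eqF//.
have Sub : ubound S 1.
  move=> s Ss; rewrite leNgt; apply/negP => s1; apply: nt1.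
  have := Sdown s 1 Ss; rewrite ler01 (ltW s1) => /(_ isT)[_].
  by rewrite mul1r.
have hsS : has_sup S by split; [exists 0|exists 1].
pose m := sup S.
have mS s : S s -> s <= m by move=> Ss; exact: sup_upper_bound.
have t10 : t1 != 0.
  by apply/eqP => t10; apply: nt1; rewrite t10 scale0r addr0.
have noS : ~ Omega (x + (m * t1) *: u).
  move=> Om; have [d d0 dP] := nbhs_parallelogram u 0
    (open_nbhs_nbhs (conj omega_open Om)).
  have t1p : 0 < `|t1| by rewrite normr_gt0.
  have : S (m + d / `|t1|).
    split; first by rewrite addr_ge0 ?mS// divr_ge0 ?ltW.
    have := dP (d / `|t1| * t1) 0; rewrite scaler0 addr0 -addrA -scalerDl -mulrDl.
    apply; last by rewrite normr0 ltW.
    by rewrite normrM normrM normfV normr_id divfK ?gt_eqF// ger0_norm// ltW.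
  by move=> /mS; rewrite gerDl leNgt divr_gt0.
have m0 : 0 < m.
  rewrite lt_neqAle mS// andbT; apply/eqP => m0; apply: noS.
  by rewrite -m0 mul0r scale0r addr0.
exists (m * t1); first by rewrite mulf_neq0// gt_eqF.
split=> // s /andP[s0 s1].
have sm : s * m < m by rewrite gtr_pMl.
have ms : 0 < m - s * m by rewrite subr_gt0.
have [s' Ss' ss'] := sup_adherent ms hsS.
have := Sdown s' (s * m) Ss'; have -> : 0 <= s * m <= s'.
  by rewrite mulr_ge0 ?(ltW m0)//= ltW//; move: ss'; rewrite subKr.
by move=> /(_ isT)[_]; rewrite mulrA.
Qed.

Lemma omega_boundary (u : nat -> V) p : (forall n, Omega (u n)) ->
  u @ \oo --> p -> ~ Omega p -> boundary Omega p.
Proof.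
move=> Ou up np; split; last first.
  by move=> ip; apply: np; exact: interior_subset.
move=> B Bp; have [N _ NP] := up _ Bp.
by exists (u N); split; [exact: Ou|exact: (NP N (leqnn N))].
Qed.

End SymmetricCone.

(** * Self-scaled barriers *)

Section Barrier.
Context {R : realType} {V : normedVectType R}.
Variables (J : euclideanJordanAlgebra V) (H : V -> R) (nu : R).
Local Notation "x ** y" := (jmul J x y) (at level 40, left associativity).
Local Notation "''[' x , y ]" := (jdot J x y).
Local Notation e := (jone J).
Local Notation Omega := (symmetric_cone J).
Hypotheses (bH : lhsc_barrier J nu H) (ssH : self_scaled J nu H).

Lemma diff_H x : Omega x -> differentiable H x.
Proof. by have [d _] := barrier_C3 bH; exact: d. Qed.

Lemma diff_DH u x : Omega x -> differentiable ('D_u H) x.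
Proof. by have [_ /(_ u)[d _]] := barrier_C3 bH; exact: d. Qed.

Lemma diff_DDH u v x : Omega x -> differentiable ('D_v ('D_u H)) x.
Proof. by have [_ /(_ u)[_ /(_ v)[d _]]] := barrier_C3 bH; exact: d. Qed.

Lemma cont_DDDH u v w x : Omega x -> {for x, continuous ('D_w ('D_v ('D_u H)))}.
Proof. by have [_ /(_ u)[_ /(_ v)[_ /(_ w) c]]] := barrier_C3 bH; exact: c. Qed.

Lemma nbhs_omega x : Omega x -> nbhs x Omega.
Proof. by move=> Ox; apply: open_nbhs_nbhs; split => //; exact: omega_open. Qed.

Lemma D2_sym x u v : Omega x -> D2 H x u v = D2 H x v u.
Proof.
move=> Ox; apply: (schwarz (omega_open J) Ox) => [y Oy|y Oy||].
- by split; apply: diff_derivable; exact: diff_H.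
- by split; apply: diff_derivable; exact: diff_DH.
- by apply: differentiable_continuous; exact: diff_DDH.
- by apply: differentiable_continuous; exact: diff_DDH.
Qed.

Lemma D3_sym23 x u v w : Omega x -> D3 H x u v w = D3 H x u w v.
Proof.
move=> Ox; apply: (schwarz (omega_open J) Ox) => [y Oy|y Oy||].
- by split; apply: diff_derivable; exact: diff_DH.
- by split; apply: diff_derivable; exact: diff_DDH.
- exact: cont_DDDH.
- exact: cont_DDDH.
Qed.

(** Differentiates [D2_sym], valid in a neighbourhood of [x]. *)
Lemma D3_sym12 x u v w : Omega x -> D3 H x u v w = D3 H x v u w.
Proof.
move=> Ox; apply: near_eq_derive; near=> y; apply: D2_sym.
by near: y; exact: nbhs_omega.
Unshelve. all: by end_near. Qed.

Lemma DH_linear x : Omega x -> forall (a : R) u v,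
  'D_(a *: u + v) H x = a * 'D_u H x + 'D_v H x.
Proof. by move=> /diff_H/derive_linear. Qed.

Lemma D2_linearr x w : Omega x -> forall (a : R) u v,
  D2 H x w (a *: u + v) = a * D2 H x w u + D2 H x w v.
Proof. by move=> /(diff_DH w)/derive_linear. Qed.

Lemma D2_linearl x w : Omega x -> forall (a : R) u v,
  D2 H x (a *: u + v) w = a * D2 H x u w + D2 H x v w.
Proof. by move=> Ox a u v; rewrite !(D2_sym _ w Ox) D2_linearr. Qed.

Lemma D3_linear3 x u v : Omega x -> forall (a : R) w z,
  D3 H x u v (a *: w + z) = a * D3 H x u v w + D3 H x u v z.
Proof. by move=> /(diff_DDH u v)/derive_linear. Qed.

Lemma D3_linear2 x u w : Omega x -> forall (a : R) v z,
  D3 H x u (a *: v + z) w = a * D3 H x u v w + D3 H x u z w.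
Proof. by move=> Ox a v z; rewrite !(D3_sym23 u _ w Ox) D3_linear3. Qed.

(** The Riesz theorem rules out the default value in [hessian] on the cone. *)
Lemma hessianP x u v : Omega x -> '[hessian J H x u, v] = D2 H x u v.
Proof.
move=> Ox; rewrite /hessian; case: xgetP => [w _ wP|none]; first exact: wP.
have [w wP] := riesz (jdot J) (D2_linearr u Ox).
by exfalso; apply: (none w).
Qed.

Lemma gradient_le x y : Omega x -> Omega y -> H x + 'D_(y - x) H x <= H y.
Proof.
move=> Ox Oy; apply: (convex_gradient_le (barrier_convex bH)) => //.
by apply: diff_derivable; exact: diff_H.
Qed.

Lemma DH_homogeneous x u (t : R) : Omega x -> 0 < t ->
  'D_u H (t *: x) = t^-1 * 'D_u H x.
Proof.
move=> Ox t0; have Otx := omegaZ t0 Ox.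
have tn0 : t != 0 by rewrite gt_eqF.
apply: (mulfI tn0); rewrite mulVKf//.
rewrite -[RHS]mul1r; apply: (@derive_scale _ _ Omega _ _ _ _ _ (- (nu * ln t))) => //.
- exact: omega_open.
- by move=> y Oy; rewrite mul1r (barrier_log_homogeneous bH).
- exact: diff_H.
- exact: diff_H.
Qed.

Lemma D2_homogeneous x u v (t : R) : Omega x -> 0 < t ->
  D2 H (t *: x) u v = (t^-1 * t^-1) * D2 H x u v.
Proof.
move=> Ox t0; have Otx := omegaZ t0 Ox.
have tn0 : t != 0 by rewrite gt_eqF.
have D1 y : Omega y -> 'D_u H (t *: y) = t^-1 * 'D_u H y + 0.
  by move=> Oy; rewrite addr0 DH_homogeneous.
have E := @derive_scale _ _ Omega ('D_u H) x v t t^-1 0 (omega_open J) Ox t0 D1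
  (diff_DH u Otx) (diff_DH u Ox).
by rewrite /D2 -mulrA -E mulKf.
Qed.

Lemma is_derive_inv1 : is_derive (1 : R) (1 : R) (fun t : R => t^-1) (- 1).
Proof.
apply: DeriveDef; first by apply: derivableV => //; exact: oner_neq0.
have E : 'D_1 (fun y : R => (id y)^-1) 1 = - (id (1 : R)) ^- 2 *: 'D_(1 : R) id (1 : R).
  by apply: deriveV => //; exact: oner_neq0.
by apply: etrans E _; rewrite derive_id /= expr1n invr1 scaleN1r.
Qed.

(** The gradient is homogeneous of degree -1. *)
Lemma D2_euler x u : Omega x -> D2 H x u x = - 'D_u H x.
Proof.
move=> Ox; rewrite -mulN1r; apply: (euler Ox) is_derive_inv1 _ => [t t0|].
  exact: DH_homogeneous.
exact: diff_DH.
Qed.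

(** The Hessian is homogeneous of degree -2. *)
Lemma D3_euler x u v : Omega x -> D3 H x u v x = - 2 * D2 H x u v.
Proof.
move=> Ox; apply: (@euler _ _ Omega _ _ (fun t => t^-1 * t^-1)) => //.
- by move=> t t0; exact: D2_homogeneous.
- have := is_deriveM is_derive_inv1 is_derive_inv1.
  by rewrite invr1 !scale1r -opprD.
- exact: diff_DDH.
Qed.

(* [dual_cone] is the closed dual cone without 0, so it may meet the boundary of
   the cone; surjectivity of the Hessian leaves room for a multiple of e. *)
Lemma hessian_cone w x : Omega w -> Omega x -> Omega (hessian J H w x).
Proof.
move=> Ow Ox; have [g _ gK] := barrier_nonsingular bH Ow.
have [t t0 tP] := nbhs_parallelogram (g e) 0 (nbhs_omega Ox).
have Oxt : Omega (x + (- t) *: g e).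
  have := tP (- t) 0; rewrite scaler0 addr0; apply; last by rewrite normr0 ltW.
  by rewrite normrN gtr0_norm.
apply: (omega_dual t0) => y Oy.
have := ssH.1 _ _ Oxt Ow y Oy => /ltW.
rewrite dotC hessianP// addrC D2_linearl//.
rewrite -!hessianP// gK dotBr dotZr (dotC _ y) (dotC _ y e).
by rewrite mulNr addrC.
Qed.

(** In the zero algebra the dual cone would be empty, against the first condition of
    self-scaling. *)
Lemma cone_nontrivial : e != 0.
Proof.
apply/eqP => e0; have O1 := omega1 J.
by have := ssH.1 _ _ O1 O1 _ O1; rewrite e0 dot0l ltxx.
Qed.

(** Adding the gradient inequalities between [x] and x + h u shows that the gradient is monotone. *)
Lemma D2_ge0 x u : Omega x -> 0 <= D2 H x u u.
Proof.
move=> Ox; rewrite leNgt; apply/negP => D0.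
have e0 : 0 < - D2 H x u u by rewrite oppr_gt0.
have du : derivable ('D_u H) x u by apply: diff_derivable; exact: diff_DH.
have [d d0 dP] := derive_approx du e0.
have [r r0 rP] := nbhs_parallelogram u 0 (nbhs_omega Ox).
pose h := Num.min (d / 2) r.
have h0 : 0 < h by rewrite lt_min divr_gt0.
have nh : `|h| = h by rewrite gtr0_norm.
have hd : h < d by rewrite gt_min ltr_pdivrMr// mulr_natr mulr2n ltrDl d0.
have Oy : Omega (x + h *: u).
  have := rP h 0; rewrite scaler0 addr0; apply; last by rewrite normr0 ltW.
  by rewrite nh ge_min lexx orbT.
have := dP h (lt0r_neq0 h0); rewrite nh => /(_ hd).
have g1 := gradient_le Ox Oy; have g2 := gradient_le Oy Ox.
have E1 : 'D_(x + h *: u - x) H x = h * 'D_u H x.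
  rewrite (addrC x) addrK -[h *: u]addr0 DH_linear//.
  by rewrite derive0 addr0.
have E2 : 'D_(x - (x + h *: u)) H (x + h *: u) = - h * 'D_u H (x + h *: u).
  have -> : x - (x + h *: u) = (- h) *: u + 0.
    by rewrite addr0 scaleNr opprD addrA subrr sub0r.
  by rewrite DH_linear// derive0 addr0.
have q0 : 0 <= h^-1 * ('D_u H (x + h *: u) - 'D_u H x).
  rewrite mulr_ge0 ?invr_ge0 ?(ltW h0)//.
  rewrite -(pmulr_rge0 _ h0); rewrite E1 in g1; rewrite E2 in g2; lra.
rewrite ltr_norml => /andP[h1 _]; rewrite -/(D2 H x u u) in h1; lra.
Qed.

(* The minimizer of H(x) + <x, x> / 2 on the cone. *)
Lemma selfdual_point : exists2 v, Omega v & forall u, 'D_u H v = - '[v, u].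
Proof.
have O1 := omega1 J.
pose f x := H x + 2^-1 * '[x, x].
pose K := [set x | Omega x /\ f x <= f e].
have cdot : continuous (fun x => '[x, x]).
  have [C C0 CP] := dot_bound (jdot J).
  move=> x; apply/cvgrPdist_lt => r r0.
  have c0 : 0 < C * (2 * `|x| + 1) by rewrite mulr_gt0// ltr_wpDl// mulr_ge0.
  near=> y.
  have xy1 : `|x - y| < 1 by near: y; apply: cvgr_dist_lt.
  have xy2 : `|x - y| < r / (C * (2 * `|x| + 1)).
    by near: y; apply: cvgr_dist_lt => //; rewrite divr_gt0.
  have -> : '[x, x] - '[y, y] = '[x - y, x + y].
    by rewrite !dotE (dotC _ y x); ring.
  rewrite (le_lt_trans (CP _ _))// mulrAC.
  rewrite ltr_pdivlMr// in xy2; apply: le_lt_trans xy2.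
  rewrite [leRHS]mulrC ler_wpM2r// ler_wpM2l ?(ltW C0)//.
  have -> : x + y = 2 *: x - (x - y).
    by rewrite scaler_nat mulr2n opprB addrACA subrr addr0 addrC.
  rewrite (le_trans (ler_normB _ _))// normrZ ger0_norm// lerD2l.
  exact: ltW.
have cf x : Omega x -> {for x, continuous f}.
  move=> Ox; apply: cvgD.
    exact: (differentiable_continuous (diff_H Ox)).
  by apply: cvgM; [exact: cvg_cst|exact: cdot].
have KO : K `<=` Omega by move=> x [].
have cK : compact K.
  apply: vect_bounded_closed_compact.
    (* Boundedness: [H] lies above its tangent at [e], which the quadratic term outgrows. *)
    have [m m0 mP] := dot_norm_ge (jdot J).
    have [C C0 CP] : exists2 C : R, 0 < C & forall u, `|'D_u H e| <= C * `|u|.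
      exact: (@vect_linear_bound R V R^o _ (DH_linear O1)).
    pose A := 2^-1 * '[e, e] + C * `|e|.
    have A0 : 0 <= A by rewrite addr_ge0 ?mulr_ge0 ?dot_ge0 ?invr_ge0 ?(ltW C0).
    exists (1 + 2 * (A + C) / m); split; first exact: num_real.
    move=> N NM x [Ox fx]; apply: le_trans (ltW NM).
    have := gradient_le O1 Ox; have := CP (x - e).
    rewrite ler_norml => /andP[D1 _] g1.
    have n1 : `|x - e| <= `|x| + `|e| by rewrite ler_normB.
    have CX : C * `|x - e| <= C * `|x| + C * `|e| by rewrite -mulrDr ler_pM2l.
    have mx := mP x; rewrite /f in fx.
    have key : m * `|x| ^+ 2 <= 2 * (A + C * `|x|) by rewrite /A; lra.
    have AC : 0 <= 2 * (A + C) / m.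
      apply: divr_ge0 (ltW m0); apply: mulr_ge0 => //.
      exact: addr_ge0 A0 (ltW C0).
    have [x1|x1] := lerP `|x| 1.
      by rewrite (le_trans x1)// lerDl.
    apply: (@le_trans _ _ (2 * (A + C) / m)); last by rewrite lerDr.
    rewrite ler_pdivlMr// -(ler_pM2r (lt_trans ltr01 x1)).
    have -> : `|x| * m * `|x| = m * `|x| ^+ 2 by ring.
    apply: le_trans key _.
    rewrite -mulrA ler_pM2l// mulrDl lerD2r.
    by rewrite ler_peMr// ltW.
  move=> p clp.
  have Op : Omega p.
    (* A limit point outside the cone is a boundary point, where [H] tends to infinity although f <=
       f e on [K]. *)
    apply: contrapT => nOp.
    have /choice[u uP] (n : nat) : exists y, K y /\ `|p - y| < n.+1%:R^-1.
      have /clp[y [Ky yp]] : nbhs p (ball p n.+1%:R^-1).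
        by apply: nbhsx_ballx; rewrite invr_gt0.
      by exists y; split=> //; move: yp; rewrite -ball_normE.
    have up : u @ \oo --> p.
      apply/cvgrPdist_lt => r r0; near=> n.
      have [_ /lt_le_trans] := uP n; apply.
      rewrite invf_ple ?posrE//.
      apply: le_trans (_ : n%:R <= _); last by rewrite ler_nat.
      near: n; exact: nbhs_infty_ger.
    have Ou n : Omega (u n) by have [[]] := uP n.
    have bp := omega_boundary Ou up nOp.
    have /cvgryPgt/(_ (f e)) := barrier_boundary bH Ou bp up.
    case=> N _ /(_ N (leqnn N)) /=; apply/negP; rewrite -leNgt.
    have [[_ fu] _] := uP N; apply: le_trans fu.
    by rewrite /f lerDl mulr_ge0 ?dot_ge0 ?invr_ge0.
  split=> //; rewrite leNgt; apply/negP => fp.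
  have : nbhs p [set x | f e < f x].
    exact: (@cvgr_gt R V (nbhs p) _ f (f p) (cf p Op) (f e) fp).
  by move=> /clp[y [[_ fy] fy']]; move: fy'; rewrite /= ltNge fy.
have K0 : K !=set0 by exists e; split.
have [|v Kv vmin] := compact_EVT_min K0 cK (f := f).
  apply: continuous_in_subspaceT => x; rewrite inE => -[Ox _]; exact: cf.
rewrite inE in Kv; have Ov := KO _ Kv.
have vmin' x : Omega x -> f v <= f x.
  move=> Ox; have [fx|fx] := lerP (f x) (f e); first by apply: vmin; rewrite inE.
  by have [_ fv] := Kv; rewrite (le_trans fv) ?ltW.
exists v => // u.
have [d d0 dP] := nbhs_parallelogram u 0 (nbhs_omega Ov).
(* Minimality bounds H(v + h u) below by H(v) - h <v, u> - h^2 <u, u> / 2. *)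
apply: (@derive_touching _ _ _ _ _ _ (2^-1 * '[u, u]) d) => //.
  by apply: diff_derivable; exact: diff_H.
move=> h hd; have Oh : Omega (v + h *: u).
  have := dP h 0; rewrite scaler0 addr0; apply; last by rewrite normr0 ltW.
  exact: ltW.
have := vmin' _ Oh; rewrite /f !dotE (dotC _ u v).
have -> : h * - '[v, u] = - (h * '[v, u]) by ring.
have -> : h ^+ 2 = h * h by rewrite expr2.
nra.
Unshelve. all: by end_near. Qed.

Lemma D3E x u v w : D3 H x u v w = 'D_w (fun y => D2 H y u v) x.
Proof. by []. Qed.

Lemma derivable_D2 x u v w : Omega x -> derivable (fun y => D2 H y u v) x w.
Proof. by move=> Ox; apply: diff_derivable; exact: diff_DDH. Qed.

(* Otherwise conversion unfolds derivatives down to filters. *)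
#[local] Opaque D2 D3 hessian.

(** * Second and third derivatives at the self-dual point *)

Section SelfdualPoint.
Variable v : V.
Hypotheses (Ov : Omega v) (Dv : forall u, 'D_u H v = - '[v, u]).
Local Notation G := (hessian J H v).

Lemma hessian_sym u w : '[G u, w] = '[u, G w].
Proof.
apply: etrans (hessianP u w Ov) _; apply: etrans (D2_sym u w Ov) _.
by apply: etrans (esym (hessianP w u Ov)) _; exact: dotC.
Qed.

Lemma hessian_linear : linear G.
Proof.
move=> a u w; apply: (dot_inj (J := J)) => z.
rewrite (hessianP _ _ Ov) (D2_linearl _ Ov) -(hessianP u z Ov) -(hessianP w z Ov).
by rewrite (dotDl _ (a *: G u) (G w)) (dotZl _ a (G u)).
Qed.

(** Euler's relation H''(v) v = - H'(v), together with H'(v) = - v. *)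
Lemma hessian_fix : G v = v.
Proof.
apply: (dot_inj (J := J)) => z.
by rewrite hessianP// D2_sym// D2_euler// Dv opprK.
Qed.

(* The gradient inequality at d^-1 v, where H' is - d v. *)
Lemma conjugate_bound s y (d : R) : 0 < d -> Omega y -> Omega (s - d *: v) ->
  - '[y, s] - H y <= - '[v, v] - H (d^-1 *: v).
Proof.
move=> d0 Oy Os; have d10 : 0 < d^-1 by rewrite invr_gt0.
have Odv := omegaZ d10 Ov.
have := gradient_le Odv Oy; rewrite DH_homogeneous// invrK Dv !dotE.
have := omega_dot_gt0 cone_nontrivial Oy Os; rewrite !dotE (dotC _ y v).
have -> : d * - ('[v, y] - d^-1 * '[v, v]) = '[v, v] - d * '[v, y].
  by field; rewrite gt_eqF.
lra.
Qed.

(* Let v + t0 u be the point where the line leaves the cone.  If l < 1, its image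
   v + l t0 u is interior, where the conjugate is bounded, against the barrier
   property; if l > 1, the image of v + (t0 / l) u is not in the cone. *)
Lemma hessian_eigenvalue u (l : R) : u != 0 -> G u = l *: u -> l = 1.
Proof.
move=> u0 Gu; have [t0 t00 [nO Os]] := omega_exit_time Ov u0.
have Gline (s : R) : G (v + s *: u) = v + (s * l) *: u.
  by rewrite addrC hessian_linear Gu hessian_fix scalerA addrC.
have l0 : 0 <= l.
  have := D2_ge0 u Ov; rewrite -hessianP// Gu dotZl pmulr_lge0// dot_gt0//.
have [l1|l1|//] := ltgtP l 1.
- exfalso; pose q := v + (l * t0) *: u.
  have Oq : Omega q by apply: Os; rewrite l0.
  pose s n : R := 1 - n.+1%:R^-1.
  have s01 n : 0 <= s n < 1.
    by rewrite subr_ge0 invf_le1// ler1n/= gtrBl invr_gt0.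
  pose x n := v + (s n * t0) *: u.
  have Ox n : Omega (x n) by exact: Os.
  have scvg : s @ \oo --> (1 : R).
    rewrite -[X in _ --> X]subr0; apply: cvgB; first exact: cvg_cst.
    exact: cvg_harmonic.
  have xcvg : x @ \oo --> v + t0 *: u.
    apply: cvgD; first exact: cvg_cst.
    apply: cvgZr_tmp; rewrite -[X in _ --> X]mul1r.
    by apply: cvgM => //; exact: cvg_cst.
  have bp := omega_boundary Ox xcvg nO.
  (* The points q + a u - d v with |a| <= d are in the cone, and the images of the [x n] are
     eventually of the form q + a u. *)
  have [d d0 dP] := nbhs_parallelogram u v (nbhs_omega Oq).
  have c0 : (fun n => (s n - 1) * (l * t0)) @ \oo --> (0 : R).
    rewrite -[X in _ --> X](mul0r (l * t0)); apply: cvgM; last exact: cvg_cst.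
    by rewrite -[X in _ --> X](subrr (1 : R)); apply: cvgB => //; exact: cvg_cst.
  have n1 : \forall n \near \oo, `|(s n - 1) * (l * t0)| <= d.
    exact: (cvgr0_norm_le _ c0 _ d0).
  have /cvgryPgt H_infty := barrier_boundary bH Ox bp xcvg.
  have n2 := H_infty (- '[v, v] - H (d^-1 *: v) + 2 * H v + nu).
  have [N _ /(_ N (leqnn N))[/= b1 b2]] := filterI n1 n2.
  have [[y Oy yE] _] := ssH.2 _ _ (Ox N) Ov.
  have Os' : Omega (G (x N) - d *: v).
    have := dP ((s N - 1) * (l * t0)) (- d) b1; rewrite normrN gtr0_norm//.
    move=> /(_ (lexx _)); congr (Omega _).
    rewrite /x Gline /q scaleNr -(addrA v) -scalerDl.
    by congr (_ + _ *: _ - _); ring.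
  by have := conjugate_bound d0 Oy Os'; rewrite yE; lra.
- exfalso; apply: nO.
  have lp : 0 < l by apply: lt_trans l1.
  have Ol : Omega (v + (l^-1 * t0) *: u).
    by apply: Os; rewrite invr_ge0 l0 /= invf_lt1.
  have := hessian_cone Ov Ol; rewrite Gline mulrAC mulVf ?gt_eqF//.
  by rewrite mul1r.
Qed.

Lemma hessian_dot u w : D2 H v u w = '[u, w].
Proof.
apply: etrans (esym (hessianP u w Ov)) _.
apply: (selfadjoint_unit_spectrum hessian_linear hessian_sym) => z l.
exact: hessian_eigenvalue.
Qed.

(* v minimizes the nonnegative function w |-> D2 H w c d. *)
Lemma D3_orthogonal_idempotents c d u : jidempotent J c -> jidempotent J d ->
  c ** d = 0 -> D3 H v c d u = 0.
Proof.
move=> cc dd cd.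
have D2pos w x y : Omega w -> Omega x -> Omega y -> 0 <= D2 H w x y.
  move=> Ow Ox Oy; rewrite -(hessianP x y Ow) ltW//.
  exact: omega_dot_gt0 cone_nontrivial (hessian_cone Ow Ox) Oy.
(* Idempotents are only limits of points of the cone: perturb [d], then [c], by multiples of [e]
   that tend to 0. *)
have D2ge w : Omega w -> 0 <= D2 H w c d.
  move=> Ow; refine (@affine_ge0 _ (D2 H w c d) (D2 H w c e) _) => t t0.
  have <- : D2 H w c (t *: e + d) = D2 H w c d + t * D2 H w c e.
    by apply: etrans (D2_linearr c Ow _ _ _) _; exact: addrC.
  refine (@affine_ge0 _ (D2 H w c (t *: e + d)) (D2 H w e (t *: e + d)) _) => r r0.
  have <- : D2 H w (r *: e + c) (t *: e + d) =
      D2 H w c (t *: e + d) + r * D2 H w e (t *: e + d).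
    by apply: etrans (D2_linearl _ Ow _ _ _) _; exact: addrC.
  by apply: D2pos => //; rewrite addrC; exact: omega_idempotentD.
have [r r0 rP] := nbhs_parallelogram u 0 (nbhs_omega Ov).
rewrite D3E; apply: (@derive_touching _ _ _ _ _ _ 0 r) => //.
  exact: derivable_D2.
move=> h hr; rewrite mulr0 addr0 mul0r subr0 hessian_dot -jdot1 cd dot0l.
apply: D2ge; have := rP h 0; rewrite scaler0 addr0; apply; first exact: ltW.
by rewrite normr0 ltW.
Qed.

(** [f u] represents b |-> D^3 H(v)[e, b, u]. The difference of the two sides is then a form to
    which [frame_form_eq0] applies. *)
Lemma D3_multiplication : exists f : V -> V,
  forall a b u, D3 H v a b u = '[f u ** a, b].
Proof.
have /choice[f fP] u : exists w, forall b, '[w, b] = D3 H v e b u.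
  exact: riesz (D3_linear2 e u Ov).
exists f => a b u; apply/eqP; rewrite -subr_eq0; apply/eqP.
apply: (@frame_form_eq0 _ _ J (fun a b => D3 H v a b u - '[f u ** a, b])).
- move=> x k y z; rewrite (D3_linear2 x u Ov) dotDr dotZr.
  by move: (D3 H v x y u) (D3 H v x z u) => p q; ring.
- move=> x y; rewrite (D3_sym12 x y u Ov) jdot_sa dotC jdot_sa.
  by rewrite [in RHS]dotC jdot_sa dotC jdot_sa.
- by move=> x; rewrite jmulr1 fP subrr.
- move=> c d cc dd cd; rewrite D3_orthogonal_idempotents// sub0r.
  by rewrite jmulC jdot_sa cd dot0r oppr0.
Qed.

Hypothesis simpleJ : jsimple J.

Lemma selfdual_point_scalar : exists2 m : R, 0 < m & (v = m *: e /\
  forall a b u, D3 H v a b u = - (2 / m) * '[u ** a, b]).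
Proof.
have [f fP] := D3_multiplication.
have fsym u a : f u ** a = f a ** u.
  apply: (dot_inj (J := J)) => b.
  by rewrite -!fP (D3_sym12 a b u Ov) (D3_sym23 b a u Ov) (D3_sym12 b u a Ov).
(* Euler's relation for the Hessian, which is the identity at [v]. *)
have fv u : f u ** v = (- 2 : R) *: u.
  apply: (dot_inj (J := J)) => b.
  rewrite -fP (D3_sym12 v b u Ov) (D3_sym23 b v u Ov) (D3_euler _ _ Ov).
  by rewrite hessian_dot dotZl dotC.
have vinj x : v ** x = 0 -> x = 0.
  move=> vx; apply/eqP/negPn/negP => x0.
  by have := (omega_posP J v).1 Ov x x0; rewrite vx dot0l ltxx.
have fva a : f (v ** a) = (- 2 : R) *: a.
  apply/eqP; rewrite -subr_eq0; apply/eqP/vinj.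
  by rewrite jBr jmulC fv jZr subrr.
(* This is [fsym] at v a and v b. *)
have nuc a b : a ** (v ** b) = b ** (v ** a).
  have := fsym (v ** a) (v ** b); rewrite !fva !jZl => h.
  have n20 : (- 2 : R) != 0 by rewrite oppr_eq0 pnatr_eq0.
  exact: (scalerI n20 h).
(* [L(v)] commutes with all multiplications, so its eigenspaces are ideals and simplicity leaves
   only one. *)
have comm a b : v ** (a ** b) = a ** (v ** b).
  apply: (dot_inj (J := J)) => d.
  rewrite jdot_sa jdot_sa (nuc a d) -jdot_sa (jmulC J d b) (nuc a b) jdot_sa.
  exact: dotC.
have fV0 : (fullv : {vspace V}) != 0%VS.
  apply: contraNneq cone_nontrivial => fV0.
  by rewrite -memv0 -fV0 memvf.
have [z [_ z0] [m vz _]] := @selfadjoint_eigenvector _ _ (jdot J) (jmul J v) fullv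
    (fun _ _ => memvf _) (jdot_sa J v) fV0.
pose I := lker (linfun (jmul J v) - m *: \1)%VF.
have memI y : (y \in I) = (v ** y == m *: y).
  by rewrite memv_ker add_lfunE opp_lfunE scale_lfunE id_lfunE lfunE subr_eq0.
have idI : jideal J I.
  move=> x y; rewrite !memI => /eqP vy.
  by rewrite comm vy jZr.
have If : I = fullv.
  case: (simpleJ idI) => // I0.
  have : z \in I by rewrite memI vz.
  by rewrite I0 memv0 (negbTE z0).
have vE : v = m *: e.
  have : e \in I by rewrite If memvf.
  by rewrite memI jmulr1 => /eqP.
have m0 : 0 < m.
  have := (omega_posP J v).1 Ov e cone_nontrivial.
  by rewrite jmulr1 {1}vE dotZl pmulr_lgt0// dot_gt0// cone_nontrivial.
exists m => //; split=> // a b u.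
rewrite fP -(dotZl _ _ (u ** a)) -jZl; congr ('[_ ** _, _]).
have {1}-> : u = v ** (m^-1 *: u).
  by rewrite vE jZl jmul1 scalerA divff ?scale1r// gt_eqF.
by rewrite fva scalerA mulNr.
Qed.

Lemma gradient_mul : exists2 m : R, 0 < m &
  forall y u, Omega y -> 'D_(u ** y) H y = - m ^+ 2 * '[e, u].
Proof.
have [m m0 [vE D3_mul]] := selfdual_point_scalar.
exists m => // y u Oy; pose x := hessian J H y y.
have Ox : Omega x := hessian_cone Oy Oy.
have xE w : '[x, w] = - 'D_w H y.
  by rewrite /x (hessianP y w Oy) (D2_sym y w Oy) (D2_euler w Oy).
(* As H''(v) x = x and x = - H'(y), convexity makes [y] the maximizer in the conjugate at [x]. *)
have max_y : H x - 2 * H v - nu = - '[y, x] - H y.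
  have Gx : hessian J H v x = x.
    apply: (dot_inj (J := J)) => w.
    by apply: etrans (hessianP x w Ov) _; exact: hessian_dot.
  have := ssH.2 _ _ Ox Ov; rewrite Gx => -[[y1 Oy1 <-] ub].
  apply: le_anti; apply/andP; split; last exact (ub _ (ex_intro2 _ _ y Oy erefl)).
  have := gradient_le Oy Oy1.
  have -> : 'D_(y1 - y) H y = - '[x, y1 - y] by rewrite xE opprK.
  rewrite dotBr (dotC _ x y1) (dotC _ x y); lra.
have ineq w : Omega w -> - '[y, hessian J H w x] - H y <= H x - 2 * H w - nu.
  move=> Ow; have [_ ub] := ssH.2 _ _ Ox Ow.
  exact (ub _ (ex_intro2 _ _ y Oy erefl)).
have [r r0 rP] := nbhs_parallelogram u 0 (nbhs_omega Ov).
(* By [ineq] and [max_y], its minimum over the cone is attained at [v]. *)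
pose f w := D2 H w x y - 2 * H w.
have df : is_derive v u f (D3 H v x y u - 2 * 'D_u H v).
  apply: is_deriveB.
    by rewrite D3E; apply: derivableP; exact: derivable_D2.
  have dH : is_derive v u H ('D_u H v).
    by apply: derivableP; apply: diff_derivable; exact: diff_H.
  exact: (is_deriveZ 2 dH).
have df0 : 'D_u f v = 0.
  apply: (@derive_touching _ _ _ _ _ _ 0 r) => // h hr.
  rewrite mulr0 addr0 mul0r subr0.
  have Oh : Omega (v + h *: u).
    have := rP h 0; rewrite scaler0 addr0; apply; first exact: ltW.
    by rewrite normr0 ltW.
  have := ineq _ Oh; rewrite (dotC _ y) (hessianP x y Oh).
  rewrite /f hessian_dot (dotC _ x y); lra.
have : D3 H v x y u - 2 * 'D_u H v = 0 by case: df => _ <-.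
rewrite D3_mul Dv vE dotZl jdot_sa xE.
move: ('D_(u ** y) H y) '[e, u] => A B.
move=> h; have : m * (- (2 / m) * - A - 2 * - (m * B)) = 0 by rewrite h mulr0.
have -> : m * (- (2 / m) * - A - 2 * - (m * B)) = 2 * (A + m ^+ 2 * B).
  by field; rewrite gt_eqF.
by move/eqP; rewrite mulf_eq0 pnatr_eq0 /= addr_eq0 mulNr => /eqP.
Qed.

End SelfdualPoint.

End Barrier.

(** * The logarithm of the determinant *)

Section LogDet.
Context {R : realType}.

Lemma ln_prod n (f : 'I_n -> R) : (forall i, 0 < f i) ->
  ln (\prod_i f i) = \sum_i ln (f i).
Proof.
move=> f0; suff [] : 0 < \prod_i f i /\ ln (\prod_i f i) = \sum_i ln (f i) by [].
elim/big_rec2: _ => [|i x y _ [y0 <-]]; first by rewrite ln1.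
by rewrite mulr_gt0// lnM// posrE.
Qed.

Lemma is_derive_scale_vector (V : normedModType R) (k : R -> R) (c : V) t dk :
  is_derive t (1 : R) k dk -> is_derive t (1 : R) (fun s => k s *: c) (dk *: c).
Proof.
move=> [dk1 <-]; have dk2 : differentiable k t by exact/derivable1_diffP.
have dkc : differentiable (fun s => k s *: c) t by exact: differentiableZl.
apply: DeriveDef; first exact/derivable1_diffP.
by rewrite deriveE// diffZl// deriveE.
Qed.

Context {V : normedVectType R}.
Variable J : euclideanJordanAlgebra V.
Local Notation "x ** y" := (jmul J x y) (at level 40, left associativity).
Local Notation "''[' x , y ]" := (jdot J x y).
Local Notation e := (jone J).
Local Notation Omega := (symmetric_cone J).

Lemma is_derive_exp_path r (c : 'I_r -> V) (l : 'I_r -> R) t :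
  is_derive t (1 : R) (fun s => \sum_i expR (l i * s) *: c i)
    (\sum_i (l i * expR (l i * t)) *: c i).
Proof.
rewrite (_ : (fun s => _) = \sum_i (fun s => expR (l i * s) *: c i)); last first.
  by apply/funext => s; rewrite fct_sumE.
apply: is_derive_sum => i; apply: is_derive_scale_vector.
have dl : is_derive t (1 : R) (fun s : R => l i * s) (l i).
  have := is_deriveZ (l i) (is_derive_id t (1 : R)).
  by rewrite [l i *: 1]mulr1.
rewrite mulrC; exact: (is_derive1_comp (is_derive_expR (l i * t)) dl).
Qed.

(** Along z(s) = exp(s X), where X is the logarithm of the given element, z' = X z; so H(z(s)) has
    the constant derivative k <e, X>, and the mean value theorem on [0, 1] gives the difference. *)
Lemma barrier_on_frame (H : V -> R) (k : R) r (c : 'I_r -> V) (l : 'I_r -> R) :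
  (forall y, Omega y -> differentiable H y) ->
  (forall y u, Omega y -> 'D_(u ** y) H y = k * '[e, u]) ->
  jordan_frame J c -> (forall i, 0 < l i) ->
  H (\sum_i l i *: c i) = H e + k * \sum_i ln (l i) * '[e, c i].
Proof.
move=> dH DH cf l0.
pose z s := \sum_i expR (ln (l i) * s) *: c i.
pose X := \sum_i ln (l i) *: c i.
have Oz s : Omega (z s).
  apply/omegaP; exists r, c, (fun i => expR (ln (l i) * s)); split => // i.
  exact: expR_gt0.
have dz s : is_derive s (1 : R) z (X ** z s).
  by rewrite (frame_mul2 cf); exact: is_derive_exp_path.
have dHz s : is_derive s (1 : R) (H \o z) (k * '[e, X]).
  have dz1 : differentiable z s by apply/derivable1_diffP; case: (dz s).
  have dHz1 : differentiable (H \o z) s.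
    by apply: differentiable_comp => //; exact: dH.
  apply: DeriveDef; first exact/derivable1_diffP.
  rewrite deriveE// diff_comp//; last exact: dH.
  rewrite /= -(deriveE _ dz1) -(deriveE _ (dH _ (Oz s))).
  by have [_ ->] := dz s; exact: DH.
have cHz : {within `[0, 1], continuous (H \o z)}.
  by apply: derivable_within_continuous => s _; case: (dHz s).
have [s _] := MVT ltr01 (fun s _ => dHz s) cHz.
rewrite subr0 mulr1 /=.
have -> : z 1 = \sum_i l i *: c i.
  by apply: eq_bigr => i _; rewrite mulr1 lnK// posrE.
have -> : z 0 = e.
  have [_ _ <-] := cf; apply: eq_bigr => i _.
  by rewrite mulr0 expR0 scale1r.
move=> E; rewrite -[LHS](subrK (H e)) E addrC; congr (_ + k * _).
by rewrite linear_sumr; apply: eq_bigr => i _; exact: dotZr.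
Qed.

End LogDet.

Theorem theorem13 (R : realType) (V : normedVectType R)
    (J : euclideanJordanAlgebra V)
    (simpleJ : jsimple J)
    (dot_tr : forall x y : V, jdot J x y = jtr J (jmul J x y))
    (H : V -> R) (ssH : self_scaled_barrier J H) :
  exists c1 c0 : R, 0 < c1 /\
    forall x : V, symmetric_cone J x -> H x = - c1 * ln (jdet J x) + c0.
Proof.
case: ssH => nu [bH sH].
have [v Ov Dv] := selfdual_point bH.
have [m m0 DH] := gradient_mul bH sH Ov Dv simpleJ.
exists (m ^+ 2), (H (jone J)); split; first by rewrite exprn_gt0.
move=> x Ox; have [c [cf xE]] := jeigenvaluesP J x.
rewrite /jdet; set s := jeigenvalues J x in c cf xE *.
have s0 (i : 'I_(size s)) : 0 < s`_i.
  by move: i; apply/(frame_posP cf); rewrite -xE; exact/omega_posP.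
rewrite {1}xE (barrier_on_frame (diff_H bH) DH cf s0) addrC; congr (_ * _ + _).
rewrite (big_nth 0) big_mkord ln_prod//; apply: eq_bigr => i _.
(* The trace form enters here: <e, c_i> = tr(c_i) = 1. *)
rewrite dot_tr jmul1 jtr_primitive ?mulr1//.
by have [] := cf.
Qed.
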